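(* Let $V$ be a complex vector space of dimension $n$ with basis $e_1,\dots,e_n$ and dual basis $e_1^*,\dots,e_n^*$, and let $0<d<n$. The following Poisson bivector fields on the Grassmannian $G(d,V)$ of $d$-dimensional subspaces of $V$ are the same: (a) the twisted standard bracket $$\pi'_{d,V}=\sum_{1\le i<j\le n}\chi(E_{ij})\wedge\chi(E_{ji})+\sum_{1\le i<j\le n}\chi(E_{ii})\wedge\chi(E_{jj});$$ (b) the bivector field induced (by the construction recalled in the context) by the polylinear map $B'_{st}:V^*\otimes V\otimes V^*\otimes V\to\mathbb C$ given by $$B'_{st}(e_i^*\otimes e_j\otimes e_k^*\otimes e_l)=\begin{cases}\delta_{ij}\delta_{kl}-\delta_{il}\delta_{jk}, & j<l,\\ -\delta_{ij}\delta_{kl}+\delta_{il}\delta_{jk}, & j>l,\\ 0,& j=l;\end{cases}$$ (c) the rescaled Feigin-Odesskii bracket $2\Pi_{W,L}$, for any vector space $W$ of dimension $d$ and any line bundle $L$ on the Kodaira cycle $C=C^n$ of length $n$ having degree $1$ on each component, where $V$ is identified with $\mathrm{Ext}^1(L,\mathcal O_C)\simeq H^0(C,L)^*$ in such a way that $(e_i)$ is the basis dual to the basis $(s_i)$ of $H^0(C,L)$ described in the context.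
   Context: We work over $\mathbb C$. Standard vector fields. The $\mathrm{GL}(V)$-action on $G(d,V)$ induces a linear map $\chi:\mathrm{End}(V)/\mathbb C\cdot\mathrm{id}\to H^0(G(d,V),T_{G(d,V)})$, and $E_{ij}\in\mathrm{End}(V)$ are the elementary matrices in the basis $(e_i)$. For $A,B\in\mathrm{End}(V)$, at a point $U\subset V$ of $G(d,V)$, with cotangent space $U\otimes U^\perp$ ($U^\perp\subset V^*$ the annihilator), the bivector $\chi(A)\wedge\chi(B)$ is the pairing $(w_1\otimes v_1^*,w_2\otimes v_2^* )\mapsto\langle v_1^*,Aw_1\rangle\langle v_2^*,Bw_2\rangle-\langle v_1^*,Bw_1\rangle\langle v_2^*,Aw_2\rangle$. Bivector from a polylinear map. Let $W$ be a vector space of dimension $d$ and let $X\subset\mathrm{Hom}(W,V)$ be the space of injective maps, so $G(d,V)=\mathrm{GL}(W)\backslash X$, $\phi\mapsto\phi(W)$. A polylinear map $B:V^*\otimes V\otimes V^*\otimes V\to\mathbb C$ with $B(v_2^*,v_2;v_1^*,v_1)=-B(v_1^*,v_1;v_2^*,v_2)$ gives a $\mathrm{GL}(W)$-invariant quadratic bivector field on $\mathrm{Hom}(W,V)=W^*\otimes V$, $$b_W(w_1\otimes v_1^*,w_2\otimes v_2^* )(\phi)=B(v_1^*,\phi(w_2),v_2^*,\phi(w_1)),$$ and the induced bivector field on $G(d,V)$ at $\phi(W)$ is the restriction of $b_W(\cdot,\cdot)(\phi)$ to $W\otimes\phi(W)^\perp$. Kodaira cycle. $C=C^n=\bigcup_{i\in\mathbb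 Z/n\mathbb Z}C_i$, $C_i\cong\mathbb P^1$ with coordinate $z_i$, where $\infty\in C_i$ is glued transversally to $0\in C_{i+1}$. Any $L$ of degree $1$ on each component is isomorphic to $\mathcal O_C(\sum_i p_i)$ with $p_i\in C_i\setminus\{0,\infty\}$; rescale the $z_i$ so that $p_i=\{z_i=1\}$, and put $x_i=z_i-1$. With $\mathbf e_i$ denoting the idempotent of the $i$-th component, the functions $s_i=(1+x_{i-1}^{-1})\mathbf e_{i-1}-x_i^{-1}\mathbf e_i$ ($i\in\mathbb Z/n\mathbb Z$), regular on $C\setminus\{p_1,\dots,p_n\}$, form a basis of $H^0(C,L)$. Using Čech cochains for the cover of $C$ by the formal neighborhood of $\{p_1,\dots,p_n\}$ and $C\setminus\{p_1,\dots,p_n\}$, the trivialization of $\omega_C$ is normalized so that the corresponding isomorphism $\tau:H^1(\mathcal O_C)\to\mathbb C$ sends the class of $x_i^{-1}\mathbf e_i$ to $1$ for each $i$; the pairing $H^0(L)\otimes H^1(L^{-1})\to\mathbb C$ is $\langle\alpha,\beta\rangle=\tau(\alpha\beta)$. Feigin-Odesskii (FO) bracket. Let $\phi:W\hookrightarrow\mathrm{Ext}^1(L,\mathcal O_C)=H^1(L^{\vee})$ correspond to the extension $0\to W^\vee\otimes\mathcal O_C\to E\to L\to0$. Let $\underline{\mathrm{End}}(E,W^\vee\otimes\mathcal O_C)\subset\underline{\mathrm{End}}(E)$ be the subbundle of endomorphisms preserving $W^\vee\otimes\mathcal O_C$; there are exact sequences $$0\to W^\vee\otimes L^\vee\to\underline{\mathrm{End}}(E,W^\vee\otimes\mathcal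 O_C)\to\underline{\mathrm{End}}(L)\oplus\mathrm{End}(W)\otimes\mathcal O_C\to0,$$ $$0\to\underline{\mathrm{End}}(E,W^\vee\otimes\mathcal O_C)\to\underline{\mathrm{End}}(E)\to W\otimes L\to0.$$ Applying $\mathrm{Hom}(\cdot,\mathcal O_C)$ to the first gives a surjection $\alpha_1:\mathrm{Hom}(\underline{\mathrm{End}}(E,W^\vee\otimes\mathcal O_C),\mathcal O_C)\to W\otimes\phi(W)^\perp=T^*_\phi G(d,V)$ (with $\phi(W)^\perp\subset H^0(L)$), and applying $R\mathrm{Hom}(\cdot,\mathcal O_C)$ to the second gives a connecting map $\delta:\mathrm{Hom}(\underline{\mathrm{End}}(E,W^\vee\otimes\mathcal O_C),\mathcal O_C)\to W^\vee\otimes H^1(L^\vee)$. Let $\alpha_2: W^\vee\otimes H^1(L^\vee)\to W^\vee\otimes (H^1(L^\vee)/\phi(W))=T_\phi G(d,V)$ be the projection. Then $\Pi_{W,L}|_\phi:T^*_\phi\to T_\phi$ is the unique map with $\Pi_{W,L}|_\phi\circ\alpha_1=\alpha_2\circ\delta$. The universal overall sign of $\Pi_{W,L}$ (depending on conventions for connecting maps and Serre duality) is a matter of normalization, and the equality in (c) is for a suitable such normalization. *)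

(* Defs.v *)
From HB Require Import structures.
From mathcomp Require Import all_boot all_order all_algebra.
From mathcomp Require Import boolp classical_sets functions cardinality fsbigop.
Set Implicit Arguments.
Unset Strict Implicit.
Unset Printing Implicit Defensive.
Import Order.TTheory GRing.Theory Num.Theory.
Local Open Scope classical_set_scope.
Local Open Scope ring_scope.

(* G(d,V) = GL(W)\{injective phi : W -> V}, where dim W = d, and
   T^*_phi = W (x) phi(W)^perp.  A bivector field is recorded by its values
   beta phi w1 v1 w2 v2 on pairs (w1 (x) v1, w2 (x) v2) of pure tensors; the
   values are meaningful only for injective phi and v1, v2 in phi(W)^perp. *)
Definition bivector_field (K : fieldType) (V W : vectType K) : Type :=
  'Hom(W, V) -> W -> 'Hom(V, K^o) -> W -> 'Hom(V, K^o) -> K.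

Definition annihilates (K : fieldType) (V W : vectType K)
  (v : 'Hom(V, K^o)) (phi : 'Hom(W, V)) : Prop := forall w : W, v (phi w) = 0.

Definition same_bivector_field (K : fieldType) (V W : vectType K)
    (beta beta' : bivector_field V W) : Prop :=
  forall phi : 'Hom(W, V), lker phi = 0%VS ->
  forall (w1 w2 : W) (v1 v2 : 'Hom(V, K^o)),
    annihilates v1 phi -> annihilates v2 phi ->
    beta phi w1 v1 w2 v2 = beta' phi w1 v1 w2 v2.

(* Given r : V -> W, the subspaces U transversal to ker r form an affine chart
   of G(d,V): each is phi(W) for a unique phi with r phi = id.  On this chart
   the function x_{w,v} : phi |-> v (phi w) has differential
   w (x) (v o (id - phi r)), an element of W (x) phi(W)^perp.
   chart_bracket is {x_{w1,v1}, x_{w2,v2}}. *)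
Definition chart_bracket (K : fieldType) (V W : vectType K)
    (beta : bivector_field V W) (r : 'Hom(V, W))
    (w1 : W) (v1 : 'Hom(V, K^o)) (w2 : W) (v2 : 'Hom(V, K^o))
    (phi : 'Hom(W, V)) : K :=
  beta phi w1 (v1 \o (\1 - (phi \o r)%VF))%VF w2 (v2 \o (\1 - (phi \o r)%VF))%VF.

(* f is polynomial on the line phi + t Y, with derivative c at t = 0. *)
Definition derivative_along (K : fieldType) (V W : vectType K)
    (f : 'Hom(W, V) -> K) (phi Y : 'Hom(W, V)) (c : K) : Prop :=
  exists2 P : {poly K}, (forall t : K, f (phi + t *: Y) = P.[t]) & P^`().[0] = c.

Definition hamiltonian_vector (K : fieldType) (V W : vectType K)
    (beta : bivector_field V W) (r : 'Hom(V, W)) (phi : 'Hom(W, V))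
    (w : W) (v : 'Hom(V, K^o)) (Y : 'Hom(W, V)) : Prop :=
  forall (w' : W) (v' : 'Hom(V, K^o)),
    v' (Y w') = chart_bracket beta r w v w' v' phi.

(* Jacobi identity for the coordinate functions of all these charts, with
   {x, f} the derivative of f along the Hamiltonian vector of x. *)
Definition poisson (K : fieldType) (V W : vectType K)
    (beta : bivector_field V W) : Prop :=
  forall (r : 'Hom(V, W)) (phi : 'Hom(W, V)), (forall w, r (phi w) = w) ->
  forall (w1 w2 w3 : W) (v1 v2 v3 : 'Hom(V, K^o)),
  exists (Y1 Y2 Y3 : 'Hom(W, V)) (c1 c2 c3 : K),
    [/\ hamiltonian_vector beta r phi w1 v1 Y1,
        hamiltonian_vector beta r phi w2 v2 Y2 &
        hamiltonian_vector beta r phi w3 v3 Y3] /\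
    [/\ derivative_along (chart_bracket beta r w2 v2 w3 v3) phi Y1 c1,
        derivative_along (chart_bracket beta r w3 v3 w1 v1) phi Y2 c2,
        derivative_along (chart_bracket beta r w1 v1 w2 v2) phi Y3 c3 &
        c1 + c2 + c3 = 0].

Definition chi_wedge (K : fieldType) (V W : vectType K) (A B : 'End(V))
    : bivector_field V W :=
  fun phi w1 v1 w2 v2 =>
    v1 (A (phi w1)) * v2 (B (phi w2)) - v1 (B (phi w1)) * v2 (A (phi w2)).

Definition elementary (K : fieldType) (V : vectType K) (n : nat)
    (e : n.-tuple V) (i j : 'I_n) : 'End(V) :=
  linfun (fun v : V => coord e j v *: tnth e i).

Definition twisted_standard (K : fieldType) (V W : vectType K) (n : nat)
    (e : n.-tuple V) : bivector_field V W :=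
  fun phi w1 v1 w2 v2 =>
    \sum_(i < n) \sum_(j < n | (i < j)%N)
      chi_wedge (elementary e i j) (elementary e j i) phi w1 v1 w2 v2 +
    \sum_(i < n) \sum_(j < n | (i < j)%N)
      chi_wedge (elementary e i i) (elementary e j j) phi w1 v1 w2 v2.

Definition polylinear_bivector (K : fieldType) (V W : vectType K)
    (B : 'Hom(V, K^o) -> V -> 'Hom(V, K^o) -> V -> K) : bivector_field V W :=
  fun phi w1 v1 w2 v2 => B v1 (phi w2) v2 (phi w1).

Definition Bst_coef (K : fieldType) (n : nat) (i j k l : 'I_n) : K :=
  if (j < l)%N then (i == j)%:R * (k == l)%:R - (i == l)%:R * (j == k)%:R
  else if (l < j)%N then
    - ((i == j)%:R * (k == l)%:R) + (i == l)%:R * (j == k)%:R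
  else 0.

Definition Bst (K : fieldType) (V : vectType K) (n : nat) (e : n.-tuple V)
    (v1' : 'Hom(V, K^o)) (v1 : V) (v2' : 'Hom(V, K^o)) (v2 : V) : K :=
  \sum_(i < n) \sum_(j < n) \sum_(k < n) \sum_(l < n)
    Bst_coef K i j k l *
    (v1' (tnth e i) * coord e j v1 * v2' (tnth e k) * coord e l v2).

(* Every point of C lies in C_i \ {oo} for exactly one i, so points are pairs
   (i, a) with z_i = a; (i, 0) is the node where oo in C_(i-1) is glued to
   0 in C_i.  A tuple f : cycle_fun is an element of the total ring of
   fractions of C, the product of the fields K(z_i). *)
Definition cycle_point (K : fieldType) (n : nat) : Type := ('I_n * K)%type.

Definition cycle_fun (K : fieldType) (n : nat) : Type :=
  'I_n -> {fraction {poly K}}.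

Local Notation "x %:F" := (tofrac x).

Definition scal (K : fieldType) (c : K) : {fraction {poly K}} := c%:P%:F.

Definition value_at (K : fieldType) (a : K) (f : {fraction {poly K}}) (c : K)
    : Prop :=
  exists P Q : {poly K},
    [/\ Q.[a] != 0, f = P%:F / Q%:F & c = P.[a] / Q.[a]].

Definition value_oo (K : fieldType) (f : {fraction {poly K}}) (c : K) : Prop :=
  exists P Q : {poly K},
    [/\ Q != 0, (size P <= size Q)%N, f = P%:F / Q%:F
      & c = P`_(size Q).-1 / lead_coef Q].

(* The local ring of C at x *)
Definition stalkO (K : fieldType) (n : nat) (x : cycle_point K n)
    : set (cycle_fun K n) :=
  [set f | exists c : K,
     value_at x.2 (f x.1) c /\ (x.2 = 0 -> value_oo (f (ord_pred x.1)) c)].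

(* Subsheaves of the constant sheaf of total fractions, given by stalks.  As C
   is reduced, every line bundle embeds there. *)
Definition cycle_sheaf (K : fieldType) (n : nat) : Type :=
  cycle_point K n -> set (cycle_fun K n).

Definition dilate (K : fieldType) (n : nat) (g : cycle_fun K n)
    (S : set (cycle_fun K n)) : set (cycle_fun K n) :=
  [set f | exists2 u, S u & f = (fun j => g j * u j)].

Definition local_generators (K : fieldType) (n : nat) (L : cycle_sheaf K n)
    (g : cycle_point K n -> cycle_fun K n) : Prop :=
  (forall x j, g x j != 0) /\ (forall x, L x = dilate (g x) (stalkO x)).

Definition line_bundle (K : fieldType) (n : nat) (L : cycle_sheaf K n) : Prop :=
  (exists g, local_generators L g) /\
  finite_set [set x : cycle_point K n | L x <> stalkO x].

Definition order_at (K : fieldType) (a : K) (f : {fraction {poly K}}) (m : int)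
    : Prop :=
  exists g c, [/\ f = ('X - a%:P)%:F ^ m * g, value_at a g c & c != 0].

Definition order_oo (K : fieldType) (f : {fraction {poly K}}) (m : int) : Prop :=
  exists g c, [/\ f = 'X%:F ^ (- m) * g, value_oo g c & c != 0].

(* The degree of the restriction of L to C_i.  A local generator of order m at
   a point contributes - m; the point oo of C_i is the node (ordS i, 0). *)
Definition degree_on (K : fieldType) (n : nat) (L : cycle_sheaf K n) (i : 'I_n)
    (delta : int) : Prop :=
  exists g (o : K -> int) (ooo : int),
    [/\ local_generators L g,
        forall a, order_at a (g (i, a) i) (o a),
        order_oo (g (ordS i, 0) i) ooo,
        finite_set [set a | o a <> 0] &
        delta = - (\sum_(a \in [set: K]) o a + ooo)].

(* x_i = z_i / p_i - 1, where z_i / p_i is the coordinate rescaled so that the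
   marked point of C_i sits at 1 *)
Definition local_coord (K : fieldType) (n : nat) (p : 'I_n -> K) (i : 'I_n)
    : {fraction {poly K}} :=
  (scal (p i))^-1 * 'X%:F - 1.

Definition marked (K : fieldType) (n : nat) (p : 'I_n -> K)
    (x : cycle_point K n) : bool := x.2 == p x.1.

(* O_C(sum_i p_i) *)
Definition O_marked (K : fieldType) (n : nat) (p : 'I_n -> K)
    : cycle_sheaf K n :=
  fun x => [set f | stalkO x (fun j =>
    (if marked p x && (j == x.1) then local_coord p j else 1) * f j)].

(* Multiplication by theta is an isomorphism L -> M; every isomorphism between
   invertible subsheaves of the total fractions has this form. *)
Definition iso_by (K : fieldType) (n : nat) (theta : cycle_fun K n)
    (L M : cycle_sheaf K n) : Prop :=
  (forall j, theta j != 0) /\ (forall x, M x = dilate theta (L x)).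

Definition std_section (K : fieldType) (n : nat) (p : 'I_n -> K) (i : 'I_n)
    : cycle_fun K n :=
  fun j => (if j == ord_pred i then 1 + (local_coord p j)^-1 else 0)
           - (if j == i then (local_coord p j)^-1 else 0).

(* Cohomology is computed with the cover of C by U1 = C \ {p_i} and U2 = the
   union of the local schemes at the p_i, whose overlap has the total fractions
   as functions.  A quasi-coherent sheaf has the same H^1 for this cover and for
   the one with completed local rings: both are its local cohomology at the p_i
   modulo sections over U1. *)

(* tau : H^1(O_C) -> K, as a functional on 1-cochains *)
Definition normalized_trace (K : fieldType) (n : nat) (p : 'I_n -> K)
    (tau : cycle_fun K n -> K) : Prop :=
  [/\ forall c f g, tau (fun j => scal c * f j + g j) = c * tau f + tau g,
      forall f, (forall x, ~~ marked p x -> stalkO x f) -> tau f = 0,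
      forall f, (forall x, marked p x -> stalkO x f) -> tau f = 0 &
      forall i, tau (fun j => if j == i then (local_coord p j)^-1 else 0) = 1].

(* The extension E of L by W^dual (x) O_C with class given by the 1-cochains
   xi_k of L^dual (k indexing a basis of W).  Its generic fibre is trivialized
   by the splitting over U1; over U2 the splitting is (f, g) |-> f + g xi.
   Elements are columns whose last entry is the image in L. *)
Definition stalkE (K : fieldType) (n d : nat) (p : 'I_n -> K)
    (L : cycle_sheaf K n) (xi : 'I_d -> cycle_fun K n) (x : cycle_point K n)
    : set ('I_n -> 'cV[{fraction {poly K}}]_(d + 1)) :=
  [set v | L x (fun j => dsubmx (v j) 0 0) /\
     forall k, stalkO x (fun j => usubmx (v j) k 0 +
       (if marked p x then dsubmx (v j) 0 0 * xi k j else 0))].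

Definition stalkEndE (K : fieldType) (n d : nat) (p : 'I_n -> K)
    (L : cycle_sheaf K n) (xi : 'I_d -> cycle_fun K n) (x : cycle_point K n)
    : set ('I_n -> 'M[{fraction {poly K}}]_(d + 1)) :=
  [set M | forall v, stalkE p L xi x v -> stalkE p L xi x (fun j => M j *m v j)].

(* End(E, W^dual (x) O_C): the endomorphisms preserving the first d coordinates *)
Definition stalkEndEW (K : fieldType) (n d : nat) (p : 'I_n -> K)
    (L : cycle_sheaf K n) (xi : 'I_d -> cycle_fun K n) (x : cycle_point K n)
    : set ('I_n -> 'M[{fraction {poly K}}]_(d + 1)) :=
  [set M | stalkEndE p L xi x M /\ forall j, dlsubmx (M j) = 0].

(* A functional on matrices over the total fractions, linear on each component *)
Definition mx_functional (K : fieldType) (n d : nat) : Type :=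
  'I_n -> {scalar 'M[{fraction {poly K}}]_(d + 1)}.

Definition hom_over (K : fieldType) (n d : nat) (U : pred (cycle_point K n))
    (F : cycle_point K n -> set ('I_n -> 'M[{fraction {poly K}}]_(d + 1)))
    (h : mx_functional K n d) : Prop :=
  forall x, U x -> forall M, F x M -> stalkO x (fun j => h j (M j)).

(* g restricts to h on End(E, W^dual (x) O_C) *)
Definition extends (K : fieldType) (n d : nat) (h g : mx_functional K n d)
    : Prop :=
  forall j M, dlsubmx M = 0 -> g j M = h j M.

Definition pure_cotangent (K : fieldType) (V W : vectType K)
    (w : W) (v : 'Hom(V, K^o)) : 'Hom(V, W) :=
  linfun (fun u : V => (v u : K) *: w).

(* Pi is the bivector Pi_{W,L} at phi, as a map T^*_phi -> T_phi.  Here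
   W (x) V^* is Hom(V, W), T^*_phi = W (x) phi(W)^perp consists of the maps
   vanishing on phi(W), and T_phi = Hom(W, V) / Hom(W, phi(W)).  V is
   H^1(L^dual) = H^0(L)^*, with (e_i) dual to the sections sigma_i = theta s_i,
   where theta is an isomorphism O_C(sum p_i) -> L; b is a basis of W.

   A homomorphism End(E, W^dual (x) O_C) -> O_C is given by any extension h to
   all matrices, only its values on matrices preserving W^dual being used.
   alpha_1 restricts it to W^dual (x) L^dual, the upper right block; the
   connecting map sends it to the difference h1 - h2 of extensions to End(E)
   over U1 and U2, on the lower left block W (x) L.  This order of the
   difference fixes the overall sign of Pi. *)
Definition FO_at (K : fieldType) (n d : nat) (V W : vectType K)
    (e : n.-tuple V) (b : d.-tuple W) (L : cycle_sheaf K n) (p : 'I_n -> K)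
    (theta : cycle_fun K n) (phi : 'Hom(W, V)) (Pi : 'Hom('Hom(V, W), 'Hom(W, V)))
    : Prop :=
  let sigma i j := theta j * std_section p i j in
  forall (tau : cycle_fun K n -> K) (xi : 'I_d -> cycle_fun K n)
         (h h1 h2 : mx_functional K n d) (a : 'Hom(V, W)) (eta : 'Hom(W, V)),
  normalized_trace p tau ->
  (* xi_k represents phi(b_k) in H^1(L^dual) *)
  (forall k i, tau (fun j => sigma i j * xi k j) = coord e i (phi (tnth b k))) ->
  hom_over predT (stalkEndEW p L xi) h ->
  (* a = alpha_1(h) *)
  (forall k j, h j (block_mx 0 (delta_mx k 0) 0 0) =
     \sum_(i < n) scal (coord b k (a (tnth e i))) * sigma i j) ->
  hom_over (fun x => ~~ marked p x) (stalkEndE p L xi) h1 -> extends h h1 ->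
  hom_over (marked p) (stalkEndE p L xi) h2 -> extends h h2 ->
  (* eta = delta(h) *)
  (forall k i, coord e i (eta (tnth b k)) =
     tau (fun j => sigma i j * (h1 j (block_mx 0 0 (delta_mx 0 k) 0) -
                                h2 j (block_mx 0 0 (delta_mx 0 k) 0)))) ->
  (limg (Pi a - eta) <= limg phi)%VS.

Definition FO_bracket (K : fieldType) (n d : nat) (V W : vectType K)
    (e : n.-tuple V) (b : d.-tuple W) (L : cycle_sheaf K n) (p : 'I_n -> K)
    (theta : cycle_fun K n)
    (Pi : 'Hom(W, V) -> 'Hom('Hom(V, W), 'Hom(W, V))) : Prop :=
  forall phi, lker phi = 0%VS -> FO_at e b L p theta phi (Pi phi).

Definition bivector_of (K : fieldType) (V W : vectType K)
    (Pi : 'Hom(W, V) -> 'Hom('Hom(V, W), 'Hom(W, V))) : bivector_field V W :=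
  fun phi w1 v1 w2 v2 => v2 (Pi phi (pure_cotangent w1 v1) w2).

(* Main.v *)
(* With a_i = v1(e_i), b_i = v2(e_i) and x, y the coordinates of phi(w1),
   phi(w2), both (a) and (b) are sum_(i,j) s_ij a_i b_j (x_i y_j + x_j y_i),
   where s_ij is the sign of j - i.

   On an affine chart the Jacobi sum of a bivector induced by r in
   End(V) (x) End(V) is the classical Yang-Baxter expression of r evaluated on
   annihilators and vectors of phi(W).  The diagonal part of r contributes
   nothing and the standard part contributes the Cartan trivector, a cyclic
   product of pairings v_i(phi w_j) = 0.

   For (c), let y_j = 1 / x_j on C_j.  The cochains y_j e_j of L^dual form the
   basis dual to (s_j), so the class of the extension is represented by
   xi_l = sum_j phi_(j l) y_j e_j up to cochains regular on U1 or on U2.  A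
   homomorphism End(E, W^dual (x) O) -> O consists of sections beta_k of L and
   functions alpha_(k l), delta on U1 such that alpha_(k l) + beta_k xi_l and
   delta - sum_k beta_k xi_k are regular at the p_i.  These sums are then constant
   on each component, and the gluing at the nodes determines the constants by a
   recursion around the cycle, up to an element acting through phi(W).  The
   connecting map sends the homomorphism to
   - sum_k alpha_(k l) xi_k - (sum_k beta_k xi_k - delta) xi_l, which tau
   evaluates because y_j^2 + y_j extends by zero to C \ {p_i}. *)

Require Import Defs.
From HB Require Import structures.
From mathcomp Require Import all_boot all_order all_algebra.
From mathcomp Require Import boolp classical_sets reals.
From mathcomp Require Import complex.
From mathcomp Require Import generic_quotient ring zify.
Import Order.TTheory GRing.Theory Num.Theory.
Local Open Scope ring_scope.
Set Implicit Arguments.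
Unset Strict Implicit.
Unset Printing Implicit Defensive.

Local Notation "x %:F" := (tofrac x).

(** Packs a linear structure from a proof of linearity, so that [linfun] can be evaluated on the
    bare lambda expressions used below. *)
Lemma linfun_linearE (K : fieldType) (aT rT : vectType K) (f : aT -> rT) :
  linear f -> linfun f =1 f.
Proof.
move=> lf.
pose g : {linear aT -> rT} :=
  HB.pack f (GRing.isLinear.Build K aT rT *:%R f lf).
exact: (lfunE g).
Qed.

Definition sgn_lt (K : fieldType) (n : nat) (i j : 'I_n) : K :=
  (i < j)%:R - (j < i)%:R.

(* Functionals are valued in the regular module [K^o]; [ev] makes the values
   elements of the field [K], so that [ring] applies to them. *)
Definition ev (K : fieldType) (V : vectType K) (v : 'Hom(V, K^o)) (u : V) : K :=
  v u.

(** * Coordinate form of the standard bracket and of the polylinear bracket *)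

Section Standard.
Variables (K : fieldType) (V W : vectType K) (n : nat) (e : n.-tuple V).
Implicit Types (phi : 'Hom(W, V)) (v : 'Hom(V, K^o)) (w : W).

Lemma sgn_ltC (i j : 'I_n) : sgn_lt K j i = - sgn_lt K i j.
Proof. by rewrite /sgn_lt opprB. Qed.

Lemma sum_sgn_lt (F : 'I_n -> 'I_n -> K) :
  \sum_(i < n) \sum_(j < n | (i < j)%N) (F i j - F j i) =
  \sum_i \sum_j sgn_lt K i j * F i j.
Proof.
under [LHS]eq_bigr do rewrite sumrB.
rewrite sumrB [X in _ - X](exchange_big_dep predT) //=.
rewrite -sumrB; apply: eq_bigr => i _.
rewrite big_mkcond [X in _ - X]big_mkcond -sumrB; apply: eq_bigr => j _.
by rewrite /sgn_lt mulrBl; do 2!case: ifP => _; rewrite ?mul1r ?mul0r.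
Qed.

Lemma elementaryE i j u : elementary e i j u = coord e j u *: tnth e i.
Proof.
rewrite /elementary linfun_linearE // => c x y.
by rewrite linearP scalerDl scalerA.
Qed.

Lemma evZ v (c : K) u : ev v (c *: u) = c * ev v u.
Proof. by rewrite /ev linearZ. Qed.

Lemma chi_wedgeE (A B : 'End(V)) phi w1 v1 w2 v2 :
  chi_wedge A B phi w1 v1 w2 v2 = ev v1 (A (phi w1)) * ev v2 (B (phi w2)) -
    ev v1 (B (phi w1)) * ev v2 (A (phi w2)).
Proof. by []. Qed.

Lemma BstE v1 u1 v2 u2 : Bst e v1 u1 v2 u2 =
  \sum_(i < n) \sum_(j < n) \sum_(k < n) \sum_(l < n) Bst_coef K i j k l *
    (ev v1 (tnth e i) * coord e j u1 * ev v2 (tnth e k) * coord e l u2).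
Proof. by []. Qed.

(** Put F i j = a_i b_j (x_i y_j + x_j y_i). For i < j the wedge of E_ij and E_ji contributes the
    x_j y_i part of F i j minus the x_i y_j part of F j i, and the wedge of E_ii and E_jj
    contributes the other two parts, so [sum_sgn_lt] applies. *)
Lemma twistedE phi w1 v1 w2 v2 :
  twisted_standard e phi w1 v1 w2 v2 =
  \sum_i \sum_j sgn_lt K i j * (ev v1 (tnth e i) * ev v2 (tnth e j) *
     (coord e i (phi w1) * coord e j (phi w2) +
      coord e j (phi w1) * coord e i (phi w2))).
Proof.
rewrite -sum_sgn_lt /twisted_standard -big_split; apply: eq_bigr => i _.
rewrite -big_split; apply: eq_bigr => j _.
rewrite /= !chi_wedgeE !elementaryE !evZ; ring.
Qed.

Lemma sum_delta (F : 'I_n -> K) j : \sum_i (i == j)%:R * F i = F j.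
Proof.
rewrite (bigD1 j) //= eqxx mul1r big1 ?addr0 // => i /negPf->.
by rewrite mul0r.
Qed.

Lemma Bst_coefE (i j k l : 'I_n) : Bst_coef K i j k l =
  sgn_lt K j l * ((i == j)%:R * (k == l)%:R - (i == l)%:R * (k == j)%:R).
Proof.
rewrite /Bst_coef /sgn_lt [j == k]eq_sym.
case: ltngtP => _ /=; ring.
Qed.

Lemma polylinear_twistedE phi w1 v1 w2 v2 :
  polylinear_bivector (Bst e) phi w1 v1 w2 v2 =
  twisted_standard e phi w1 v1 w2 v2.
Proof.
rewrite twistedE /polylinear_bivector BstE.
transitivity (\sum_j \sum_l sgn_lt K j l *
  (ev v1 (tnth e j) * ev v2 (tnth e l) - ev v1 (tnth e l) * ev v2 (tnth e j)) *
  (coord e j (phi w2) * coord e l (phi w1))).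
  rewrite exchange_big; apply: eq_bigr => j _.
  under eq_bigr do rewrite exchange_big.
  rewrite exchange_big; apply: eq_bigr => l _.
  pose x := sgn_lt K j l * coord e j (phi w2) * coord e l (phi w1).
  transitivity (\sum_i ((i == j)%:R * (x * ev v1 (tnth e i) * ev v2 (tnth e l)) -
     (i == l)%:R * (x * ev v1 (tnth e i) * ev v2 (tnth e j)))).
    apply: eq_bigr => i _; rewrite -(sum_delta (fun k => ev v2 (tnth e k))).
    rewrite -(sum_delta (fun k => ev v2 (tnth e k)) j) !mulr_sumr -sumrB.
    apply: eq_bigr => k _; rewrite Bst_coefE /x; ring.
  by rewrite sumrB !sum_delta /x; ring.
(* [G] and [H] are the two products of covector values; [H] enters with its indices exchanged, which
   flips the sign, and relabelling turns the difference into a sum. *)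
pose G (j l : 'I_n) : K :=
  ev v1 (tnth e j) * ev v2 (tnth e l) * (coord e j (phi w2) * coord e l (phi w1)).
pose H (j l : 'I_n) : K :=
  ev v1 (tnth e j) * ev v2 (tnth e l) * (coord e l (phi w2) * coord e j (phi w1)).
transitivity (\sum_j \sum_l (sgn_lt K j l * G j l + sgn_lt K l j * H l j)).
  apply: eq_bigr => j _; apply: eq_bigr => l _.
  rewrite (sgn_ltC j l) /G /H; ring.
under eq_bigr do rewrite big_split.
rewrite big_split /= [X in _ + X]exchange_big -big_split; apply: eq_bigr => j _.
rewrite /= -big_split; apply: eq_bigr => l _; rewrite /= /G /H; ring.
Qed.

End Standard.

(** * The Jacobi identity *)

Section RMatrix.
Variables (K : fieldType) (n : nat).
Implicit Types (A B C : 'M[K]_n) (a b c : 'rV[K]_n) (x y z : 'cV[K]_n).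

(** The standard classical r-matrix of gl_n as an operator: it keeps the strictly lower triangular
    part, negates the strictly upper one and kills the diagonal. *)
Definition rmap A : 'M[K]_n := \matrix_(j, k) (sgn_lt K k j * A j k).

Lemma tr_mul3 A B C :
  \tr (A *m B *m C) = \sum_j \sum_k \sum_l A j k * B k l * C l j.
Proof.
apply: eq_bigr => j _; rewrite mxE.
under eq_bigr do rewrite mxE mulr_suml.
by rewrite exchange_big.
Qed.

(** For distinct indices, two of the three signs agree and the third is opposite; when exactly two
    indices coincide, one sign is 0 and the other two are opposite. Either way the products sum to
    -1, and only j = k = l gives 0. *)
Lemma sgn_lt_cycle (j k l : 'I_n) :
  sgn_lt K k j * sgn_lt K l k + sgn_lt K k j * sgn_lt K j l +
  sgn_lt K l k * sgn_lt K j l = ((j == k) && (k == l))%:R - 1.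
Proof.
rewrite /sgn_lt -!val_eqE /=.
case: (ltngtP j k) => jk; case: (ltngtP k l) => kl; case: (ltngtP j l) => jl;
  rewrite /=; try ring; exfalso; lia.
Qed.

(* The modified classical Yang-Baxter equation for [rmap], paired with the
   trace form. *)
Lemma rmap_mcybe A B C :
  \tr (rmap A *m rmap B *m C) + \tr (rmap A *m B *m rmap C) +
  \tr (A *m rmap B *m rmap C) =
  \sum_j A j j * B j j * C j j - \tr (A *m B *m C).
Proof.
rewrite !tr_mul3 -!big_split -sumrB; apply: eq_bigr => j _ /=.
rewrite -!big_split.
transitivity (\sum_k ((j == k)%:R * (A j k * B k k * C k j) -
   \sum_l A j k * B k l * C l j)).
  apply: eq_bigr => k _; rewrite -!big_split /=.
  rewrite -[_ * (A j k * _ * _)](sum_delta (fun l => (j == k)%:R *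
    (A j k * B k l * C l j)) k) -sumrB; apply: eq_bigr => l _.
  rewrite !mxE; have := sgn_lt_cycle j k l; rewrite [l == k]eq_sym.
  move: (sgn_lt K k j) (sgn_lt K l k) (sgn_lt K j l) => s t u.
  rewrite -mulnb natrM => /(congr1 (fun w => w * (A j k * B k l * C l j))) E.
  transitivity ((s * t + s * u + t * u) * (A j k * B k l * C l j)); first ring.
  rewrite E; ring.
rewrite sumrB; congr (_ - _).
under eq_bigr do rewrite eq_sym.
by rewrite (sum_delta (fun k => A j k * B k k * C k j)).
Qed.

(** [rmap] is skew for the trace form and commutes with multiplication by a diagonal matrix, which
    only rescales entries. This cancels the mixed terms of the Jacobi sum. *)
Lemma tr_rmap_diag (d : 'rV[K]_n) A B :
  \tr (rmap B *m diag_mx d *m A) = - \tr (diag_mx d *m rmap A *m B).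
Proof.
rewrite mul_mx_diag mul_diag_mx.
transitivity (\sum_j \sum_k - (d 0 k * rmap A k j * B j k)).
  apply: eq_bigr => j _; rewrite mxE; apply: eq_bigr => k _.
  by rewrite !mxE [in LHS]sgn_ltC; ring.
rewrite exchange_big -sumrN; apply: eq_bigr => j _.
rewrite mxE -sumrN; apply: eq_bigr => k _; by rewrite !mxE.
Qed.

(* The matrix of [(a (x) id) r], where [r] is the tensor of the bracket,
   contracted with [x] in the first factor. *)
Definition contr_diag a x : 'rV[K]_n :=
  \row_j \sum_i sgn_lt K i j * (a 0 i * x i 0).

Definition contr a x : 'M[K]_n := rmap (x *m a) + diag_mx (contr_diag a x).

(** Written as traces of the rank-one matrices x a, y b, z c, the purely diagonal terms commute away
    and the mixed terms cancel by skewness. What remains is the difference of two Yang-Baxter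
    identities in opposite cyclic orders: their diagonal sums agree, and their cubic traces contain
    the factor a z or a y. *)
Lemma contr_jacobi a b c x y z :
  a *m y = 0 -> a *m z = 0 ->
  let R1 := contr a x in let R2 := contr b y in let R3 := contr c z in
  b *m (R1 *m R3 - R3 *m R1) *m y + c *m (R2 *m R1 - R1 *m R2) *m z +
  a *m (R3 *m R2 - R2 *m R3) *m x = 0.
Proof.
move=> ay az R1 R2 R3.
have tr11 (M : 'M[K]_1) : M = (\tr M)%:M.
  by rewrite /mxtrace big_ord1 -mx11_scalar.
have trE (r : 'rV[K]_n) (M : 'M[K]_n) (u : 'cV[K]_n) :
    \tr (r *m M *m u) = \tr (M *m (u *m r)).
  by rewrite !mulmxA [RHS]mxtrace_mulC mulmxA.
rewrite [LHS]tr11 !mxtraceD !trE.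
have cyc A B C : \tr (A *m B *m C) = \tr (B *m C *m A).
  by rewrite -mulmxA mxtrace_mulC.
rewrite /R1 /R2 /R3 /contr.
set M1 := x *m a; set M2 := y *m b; set M3 := z *m c.
set D1 := diag_mx (contr_diag a x); set D2 := diag_mx (contr_diag b y).
set D3 := diag_mx (contr_diag c z).
have e13 : D1 *m D3 = D3 *m D1 by exact: diag_mxC.
have e21 : D2 *m D1 = D1 *m D2 by exact: diag_mxC.
have e32 : D3 *m D2 = D2 *m D3 by exact: diag_mxC.
have G1 := rmap_mcybe M1 M3 M2; have G2 := rmap_mcybe M1 M2 M3.
have z132 : \tr (M1 *m M3 *m M2) = 0.
  by rewrite /M1 /M3 mulmxA -(mulmxA x) az mulmx0 !mul0mx mxtrace0.
have z123 : \tr (M1 *m M2 *m M3) = 0.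
  by rewrite /M1 /M2 mulmxA -(mulmxA x) ay mulmx0 !mul0mx mxtrace0.
have dE : \sum_j M1 j j * M3 j j * M2 j j = \sum_j M1 j j * M2 j j * M3 j j.
  by apply: eq_bigr => j _; rewrite mulrAC.
apply: etrans (raddf0 (@scalar_mx K 1)); congr (_%:M).
rewrite !(mulmxDl, mulmxDr, mulNmx, mulmxN).
rewrite !(mxtraceD, raddfN) /= !mxtraceD !tr_rmap_diag e13 e21 e32.
rewrite (cyc (rmap M2) (rmap M1)) (cyc (rmap M3) (rmap M1)).
rewrite -(cyc M1 (rmap M3)) -(cyc M1 (rmap M2)).
rewrite z132 dE in G1; rewrite z123 -G1 in G2.
move/eqP: G2; rewrite -subr_eq0 => /eqP G2.
rewrite -[RHS]oppr0 -[in RHS]G2; ring.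
Qed.

End RMatrix.

(** * From matrices to endomorphisms of V, and the Jacobi sum on an affine chart *)

Section Poisson.
Variables (K : fieldType) (V W : vectType K) (n : nat) (e : n.-tuple V).
Hypothesis he : basis_of fullv e.
Implicit Types (phi : 'Hom(W, V)) (v : 'Hom(V, K^o)) (w : W) (u : V).

Lemma coord_basisE u : u = \sum_i coord e i u *: tnth e i.
Proof.
rewrite {1}(coord_basis he (memvf u)).
by apply: eq_bigr => i _; rewrite (tnth_nth 0).
Qed.

Lemma coord_tnth i j : coord e i (tnth e j) = (i == j)%:R.
Proof. by rewrite (tnth_nth 0) (coord_free _ _ (basis_free he)) eq_sym. Qed.

Definition std_form v1 u1 v2 u2 : K :=
  \sum_i \sum_j sgn_lt K i j * (ev v1 (tnth e i) * ev v2 (tnth e j) *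
    (coord e i u1 * coord e j u2 + coord e j u1 * coord e i u2)).

Lemma std_formC v1 u1 v2 u2 : std_form v2 u2 v1 u1 = - std_form v1 u1 v2 u2.
Proof.
rewrite /std_form exchange_big -sumrN; apply: eq_bigr => i _.
rewrite -sumrN; apply: eq_bigr => j _; rewrite (sgn_ltC K i j); ring.
Qed.

Definition contr_end v1 u1 : 'End(V) := linfun (fun u =>
  \sum_j (\sum_i sgn_lt K i j * ev v1 (tnth e i) *
    (coord e i u1 * coord e j u + coord e j u1 * coord e i u)) *: tnth e j).

Lemma contr_endE v1 u1 u : contr_end v1 u1 u =
  \sum_j (\sum_i sgn_lt K i j * ev v1 (tnth e i) *
    (coord e i u1 * coord e j u + coord e j u1 * coord e i u)) *: tnth e j.
Proof.
rewrite /contr_end linfun_linearE // => c x y.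
rewrite scaler_sumr -big_split; apply: eq_bigr => j _ /=.
rewrite scalerA -scalerDl; congr (_ *: _).
rewrite mulr_sumr -big_split; apply: eq_bigr => i _ /=.
by rewrite !linearP /=; ring.
Qed.

Lemma ev_sum v (F : 'I_n -> V) : ev v (\sum_i F i) = \sum_i ev v (F i).
Proof. by rewrite /ev linear_sum. Qed.

Lemma std_form_contr v1 u1 v2 u2 :
  std_form v1 u1 v2 u2 = ev v2 (contr_end v1 u1 u2).
Proof.
rewrite contr_endE ev_sum /std_form exchange_big; apply: eq_bigr => j _.
rewrite evZ mulr_suml; apply: eq_bigr => i _; ring.
Qed.

Definition ev_row v : 'rV[K]_n := \row_i ev v (tnth e i).
Definition coord_col u : 'cV[K]_n := \col_i coord e i u.

Lemma ev_mul v u : ev v u = (ev_row v *m coord_col u) 0 0.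
Proof.
rewrite [in LHS](coord_basisE u) ev_sum mxE; apply: eq_bigr => i _.
by rewrite evZ !mxE mulrC.
Qed.

(** The terms carrying coordinate j of u1 form the rank-one part under [rmap]; the others multiply
    coordinate j of u by a factor free of u, which is the diagonal part. *)
Lemma contr_end_col v1 u1 u :
  coord_col (contr_end v1 u1 u) =
  contr (ev_row v1) (coord_col u1) *m coord_col u.
Proof.
apply/colP => j; rewrite contr_endE !mxE linear_sum /=.
under eq_bigr do rewrite linearZ /= coord_tnth mulrC eq_sym.
rewrite sum_delta; transitivity (\sum_i (sgn_lt K i j * (coord e j u1 *
  ev v1 (tnth e i)) * coord e i u +
  (i == j)%:R * (\sum_k sgn_lt K k j * ev v1 (tnth e k) * coord e k u1) *
  coord e i u)).
  under [RHS]eq_bigr do rewrite -[_%:R * _ * _]mulrA.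
  rewrite big_split /= sum_delta mulr_suml -big_split.
  by apply: eq_bigr => i _ /=; ring.
apply: eq_bigr => i _; rewrite -mulrDl; congr (_ * _); last by rewrite mxE.
rewrite !mxE big_ord1 !mxE; congr (_ + _).
rewrite [i == j]eq_sym -[RHS]mulr_natl; congr (_ * _).
by apply: eq_bigr => k _; rewrite !mxE mulrA.
Qed.

Lemma contr_end_jacobi v1 v2 v3 u1 u2 u3 :
  ev v1 u2 = 0 -> ev v1 u3 = 0 ->
  let R1 := contr_end v1 u1 in let R2 := contr_end v2 u2 in
  let R3 := contr_end v3 u3 in
  ev v2 (R1 (R3 u2)) - ev v2 (R3 (R1 u2)) +
  (ev v3 (R2 (R1 u3)) - ev v3 (R1 (R2 u3))) +
  (ev v1 (R3 (R2 u1)) - ev v1 (R2 (R3 u1))) = 0.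
Proof.
move=> z2 z3 /=.
have z0 v u : ev v u = 0 -> ev_row v *m coord_col u = 0.
  by move=> vu; rewrite [LHS]mx11_scalar -ev_mul vu raddf0.
have := contr_jacobi (ev_row v2) (ev_row v3) (coord_col u1) (z0 _ _ z2)
  (z0 _ _ z3).
move=> /(congr1 (fun M : 'M_1 => M 0 0)) J.
have addE (M N : 'M[K]_1) : (M + N) 0 0 = M 0 0 + N 0 0 by rewrite mxE.
have oppE (M : 'M[K]_1) : (- M) 0 0 = - M 0 0 by rewrite mxE.
rewrite /= [RHS]mxE in J; rewrite -[RHS]J !ev_mul !contr_end_col.
move: (contr (ev_row v1) _) (contr (ev_row v2) _) (contr (ev_row v3) _).
move=> R1 R2 R3; rewrite !(mulmxDr, mulmxDl, mulmxN, mulNmx) !mulmxA.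
by rewrite !(addE, oppE).
Qed.

Lemma evD v u u' : ev v (u + u') = ev v u + ev v u'.
Proof. by rewrite /ev linearD. Qed.

Lemma ev_comp v r phi u : ev (v \o (phi \o r))%VF u = ev v (phi (r u)).
Proof. by rewrite /ev !comp_lfunE. Qed.

Lemma ev_chart v r phi u :
  ev (v \o (\1 - (phi \o r)%VF))%VF u = ev v u - ev v (phi (r u)).
Proof.
by rewrite /ev comp_lfunE add_lfunE opp_lfunE comp_lfunE id_lfunE linearB.
Qed.

Lemma chart_twisted r w1 v1 w2 v2 phi :
  chart_bracket (twisted_standard e) r w1 v1 w2 v2 phi =
  std_form (v1 \o (\1 - (phi \o r)%VF))%VF (phi w1)
           (v2 \o (\1 - (phi \o r)%VF))%VF (phi w2).
Proof. exact: twistedE. Qed.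

(** Along phi + t Y each covector v o (id - phi r) and each vector phi w is affine in t, with slopes
    - v Y r and Y w. The bracket is multilinear in them, so it is a polynomial in t and the product
    rule gives four terms. *)
Lemma derivative_chart r w2 v2 w3 v3 phi Y :
  let q v : 'Hom(V, K^o) := (v \o (\1 - (phi \o r)%VF))%VF in
  let q' v : 'Hom(V, K^o) := (v \o (Y \o r))%VF in
  derivative_along (chart_bracket (twisted_standard e) r w2 v2 w3 v3) phi Y
    (- std_form (q' v2) (phi w2) (q v3) (phi w3) +
     std_form (q v2) (Y w2) (q v3) (phi w3) -
     std_form (q v2) (phi w2) (q' v3) (phi w3) +
     std_form (q v2) (phi w2) (q v3) (Y w3)).
Proof.
move=> q q'.
pose L (c c' : K) : {poly K} := c%:P + c'%:P * 'X.
pose lv v i := L (ev (q v) (tnth e i)) (- ev (q' v) (tnth e i)).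
pose lw w i := L (coord e i (phi w)) (coord e i (Y w)).
exists (\sum_i \sum_j (sgn_lt K i j)%:P *
  (lv v2 i * lv v3 j * (lw w2 i * lw w3 j + lw w2 j * lw w3 i))).
  move=> t; rewrite chart_twisted horner_sum; apply: eq_bigr => i _.
  rewrite horner_sum; apply: eq_bigr => j _.
  have evE v k : ev (v \o (\1 - ((phi + t *: Y) \o r)%VF))%VF (tnth e k) =
      (lv v k).[t].
    rewrite /lv /L !hornerE !ev_chart add_lfunE scale_lfunE.
    by rewrite evD evZ /q' ev_comp; ring.
  have coordE w k : coord e k ((phi + t *: Y) w) = (lw w k).[t].
    by rewrite /lw /L !hornerE add_lfunE scale_lfunE linearD linearZ /= mulrC.
  rewrite !evE !coordE; move: (lv v2 i) (lv v3 j) (lw w2 i) (lw w3 j) => A B C D.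
  by rewrite !hornerE.
rewrite raddf_sum horner_sum /std_form -!sumrN -!big_split.
apply: eq_bigr => i _ /=.
rewrite raddf_sum horner_sum -!sumrN -!big_split; apply: eq_bigr => j _ /=.
rewrite /lv /lw /L !derivE !hornerE /=; ring.
Qed.

(** The factor id - phi r of the second covector is moved onto the contracted vector. *)
Lemma hamiltonian_twisted r w v phi :
  hamiltonian_vector (twisted_standard e) r phi w v
    ((\1 - (phi \o r)%VF) \o
     (contr_end (v \o (\1 - (phi \o r)%VF))%VF (phi w) \o phi))%VF.
Proof.
move=> w' v'; rewrite chart_twisted std_form_contr /ev.
by rewrite !comp_lfunE.
Qed.

Lemma poisson_twisted : poisson (W := W) (twisted_standard e).
Proof.
move=> r phi rphi w1 w2 w3 v1 v2 v3.
pose q v : 'Hom(V, K^o) := (v \o (\1 - (phi \o r)%VF))%VF.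
pose R v w := contr_end (q v) (phi w).
pose Y v w := ((\1 - (phi \o r)%VF) \o (R v w \o phi))%VF.
exists (Y v1 w1), (Y v2 w2), (Y v3 w3).
do 3!eexists; split; first by split; exact: hamiltonian_twisted.
split; [exact: derivative_chart.. |].
have q'E v' v w u : ev (v' \o (Y v w \o r))%VF u = ev (q v') (R v w (phi (r u))).
  by rewrite /ev !comp_lfunE.
have YE v w w' : Y v w w' = R v w (phi w') - phi (r (R v w (phi w'))).
  by rewrite /Y !comp_lfunE add_lfunE opp_lfunE !comp_lfunE id_lfunE.
rewrite -!/(q _).
(* [F1] to [F4] rewrite the four terms of the product rule. The compositions passing through phi r
   cancel in the cyclic sum; the remaining ones form the expression of [contr_end_jacobi]. *)
have F1 v w v' w' v'' w'' :
  - std_form (v' \o (Y v w \o r))%VF (phi w') (q v'') (phi w'') =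
  ev (q v') (R v w (phi (r (R v'' w'' (phi w'))))).
  by rewrite -std_formC std_form_contr q'E.
have F2 v w v' w' v'' w'' :
  std_form (q v') (Y v w w') (q v'') (phi w'') =
  ev (q v') (R v'' w'' (phi (r (R v w (phi w'))))) -
  ev (q v') (R v'' w'' (R v w (phi w'))).
  rewrite -[LHS]opprK -std_formC std_form_contr YE -/(R _ _).
  by rewrite /ev !linearB /= opprB.
have F3 v w v' w' v'' w'' :
  std_form (q v') (phi w') (v'' \o (Y v w \o r))%VF (phi w'') =
  ev (q v'') (R v w (phi (r (R v' w' (phi w''))))).
  by rewrite std_form_contr q'E.
have F4 v w v' w' v'' w'' :
  std_form (q v') (phi w') (q v'') (Y v w w'') =
  ev (q v'') (R v' w' (R v w (phi w''))) -
  ev (q v'') (R v' w' (phi (r (R v w (phi w''))))).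
  by rewrite std_form_contr YE -/(R _ _) /ev !linearB.
rewrite !F1 !F2 !F3 !F4.
(* Since r phi = id, the projected covectors annihilate phi(W). *)
have q0 v w : ev (q v) (phi w) = 0 by rewrite ev_chart rphi subrr.
rewrite -[RHS](contr_end_jacobi (q v2) (q v3) (phi w1)
  (q0 v1 w2) (q0 v1 w3)) -/(R _ _) -/(R _ _) -/(R _ _); ring.
Qed.

End Poisson.

(** * Rational functions on the components *)

HB.instance Definition _ (K : fieldType) :=
  GRing.RMorphism.copy (@scal K) (@tofrac {poly K} \o polyC).

Section Values.
Variable K : fieldType.
Implicit Types (f g : {fraction {poly K}}) (P Q : {poly K}) (a c : K).

Lemma fraction_ex f : exists P Q, Q != 0 /\ f = P%:F / Q%:F.
Proof.
elim/quotW: f => r; exists (frac r).1, (frac r).2.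
have d0 := denom_ratioP r; split=> //.
apply: (canRL (mulfK _)); first by rewrite tofrac_eq0.
rewrite /tofrac; unlock FracField.tofrac; rewrite !piE.
apply/eqmodP; rewrite /= FracField.equivfE /FracField.mulf.
by rewrite !numden_Ratio ?mulf_neq0 ?oner_eq0 // ?mulr1 mulrC.
Qed.

Lemma fracE P Q P' Q' : Q != 0 -> Q' != 0 ->
  (P%:F / Q%:F == P'%:F / Q'%:F) = (P * Q' == P' * Q).
Proof.
by move=> q q'; rewrite eqr_div ?tofrac_eq0 // -!tofracM tofrac_eq.
Qed.

Lemma horner_neq0 a Q : Q.[a] != 0 -> Q != 0.
Proof. by apply: contraNneq => ->; rewrite horner0. Qed.

Lemma value_at_frac a P Q : Q.[a] != 0 ->
  value_at a (P%:F / Q%:F) (P.[a] / Q.[a]).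
Proof. by exists P, Q. Qed.

Lemma value_at_poly a P : value_at a P%:F P.[a].
Proof.
by exists P, 1; rewrite !hornerE oner_eq0 tofrac1 !divr1.
Qed.

Lemma value_at_scal a c : value_at a (scal c) c.
Proof. by have := value_at_poly a c%:P; rewrite hornerC. Qed.

Lemma value_at_inj a f c c' : value_at a f c -> value_at a f c' -> c = c'.
Proof.
move=> [P [Q [q -> ->]]] [P' [Q' [q' /eqP E ->]]].
move: E; rewrite fracE ?(horner_neq0 q) ?(horner_neq0 q') // => /eqP.
move/(congr1 (fun R : {poly K} => R.[a])); rewrite !hornerE => E.
by apply/eqP; rewrite eqr_div // E.
Qed.

Lemma value_atD a f g c c' :
  value_at a f c -> value_at a g c' -> value_at a (f + g) (c + c').
Proof.
move=> [P [Q [q -> ->]]] [P' [Q' [q' -> ->]]].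
exists (P * Q' + P' * Q), (Q * Q'); rewrite !hornerE mulf_neq0 //; split=> //.
  rewrite rmorphD !rmorphM addf_div // tofrac_eq0.
    exact: horner_neq0 q.
  exact: horner_neq0 q'.
by rewrite addf_div.
Qed.

Lemma value_atM a f g c c' :
  value_at a f c -> value_at a g c' -> value_at a (f * g) (c * c').
Proof.
move=> [P [Q [q -> ->]]] [P' [Q' [q' -> ->]]].
exists (P * P'), (Q * Q'); rewrite !hornerM mulf_neq0 //; split=> //.
  by rewrite !rmorphM mulf_div.
by rewrite mulf_div.
Qed.

Lemma value_atV a f c : value_at a f c -> c != 0 -> value_at a f^-1 c^-1.
Proof.
move=> [P [Q [q -> ->]]] c0; exists Q, P; rewrite !invf_div; split=> //.
by apply: contraNneq c0 => ->; rewrite mul0r.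
Qed.

Lemma value_oo_scal c : value_oo (scal c) c.
Proof.
exists c%:P, 1; rewrite oner_eq0 size_poly1 size_polyC_leq1 divr1; split=> //.
by rewrite lead_coef1 divr1 coefC.
Qed.

(* The coefficient in degree (size Q).-1 is multiplicative on such pairs, which
   is why the value at infinity is. *)
Lemma coef_top_mul (P Q : {poly K}) m n :
  (size P <= m.+1)%N -> (size Q <= n.+1)%N -> (P * Q)`_(m + n) = P`_m * Q`_n.
Proof.
move=> sP sQ; rewrite coefM.
have mlt : (m < (m + n).+1)%N by lia.
rewrite (bigD1 (Ordinal mlt)) //= addKn big1 ?addr0 // => i /eqP im.
have [lt|ge] := ltnP m i; first by rewrite [P`__]nth_default ?mul0r //;
  apply: leq_trans sP _.
rewrite [Q`_ _]nth_default ?mulr0 //.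
apply: leq_trans sQ _; have : (i : nat) <> m.
  by move=> E; apply: im; apply: val_inj.
by lia.
Qed.

Lemma size_predS P : P != 0 -> size P = (size P).-1.+1.
Proof. by rewrite -size_poly_gt0 => /prednK. Qed.

Lemma value_oo_inj f c c' : value_oo f c -> value_oo f c' -> c = c'.
Proof.
move=> [P [Q [q sP -> ->]]] [P' [Q' [q' sP' /eqP E ->]]].
move: E; rewrite fracE // => /eqP.
move/(congr1 (fun R : {poly K} => R`_((size Q).-1 + (size Q').-1))).
rewrite coef_top_mul -?size_predS // addnC coef_top_mul -?size_predS // => E.
by apply/eqP; rewrite eqr_div ?lead_coef_eq0 // !lead_coefE E.
Qed.

Lemma value_ooD f g c c' :
  value_oo f c -> value_oo g c' -> value_oo (f + g) (c + c').
Proof.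
move=> [P [Q [q sP -> ->]]] [P' [Q' [q' sP' -> ->]]].
exists (P * Q' + P' * Q), (Q * Q'); rewrite mulf_neq0 //; split=> //.
- rewrite size_mul //.
  apply: leq_trans (size_polyD _ _) _; rewrite geq_max.
  apply/andP; split; apply: leq_trans (size_polyMleq _ _) _.
    by rewrite -!subn1 leq_sub2r // leq_add2r.
  by rewrite -!subn1 leq_sub2r // addnC leq_add2l.
- by rewrite rmorphD !rmorphM addf_div // tofrac_eq0.
rewrite addf_div ?lead_coef_eq0 // lead_coefM (size_mul q q'); congr (_ / _).
have -> : (size Q + size Q').-2 = ((size Q).-1 + (size Q').-1)%N.
  by move: (size_predS q) (size_predS q'); lia.
rewrite coefD coef_top_mul -?size_predS // [((size Q).-1 + _)%N]addnC.
by rewrite coef_top_mul -?size_predS // addrC.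
Qed.

Lemma value_ooM f g c c' :
  value_oo f c -> value_oo g c' -> value_oo (f * g) (c * c').
Proof.
move=> [P [Q [q sP -> ->]]] [P' [Q' [q' sP' -> ->]]].
exists (P * P'), (Q * Q'); rewrite mulf_neq0 //; split=> //.
- rewrite (size_mul q q'); apply: leq_trans (size_polyMleq _ _) _.
  by rewrite -!subn1 leq_sub2r // leq_add.
- by rewrite !rmorphM mulf_div.
rewrite mulf_div lead_coefM (size_mul q q'); congr (_ / _).
have -> : (size Q + size Q').-2 = ((size Q).-1 + (size Q').-1)%N.
  by move: (size_predS q) (size_predS q'); lia.
by rewrite coef_top_mul -?size_predS //.
Qed.

End Values.

(** * Poles and principal parts on a single projective line *)

Section Components.
Variable K : closedFieldType.
Implicit Types (f g : {fraction {poly K}}) (P Q : {poly K}) (a c p : K).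

(** Over an algebraically closed field the denominator of the reduced fraction has no root, hence is
    constant; finiteness at infinity then bounds the degree of the polynomial by 0. *)
Lemma regular_constant f c :
  (forall a, exists c, value_at a f c) -> value_oo f c -> f = scal c.
Proof.
move=> freg foo; have [P [Q [q fE]]] := fraction_ex f.
pose D := gcdp P Q; pose P1 := P %/ D; pose Q1 := Q %/ D.
have D0 : D != 0 by rewrite gcdp_eq0 (negPf q) andbF.
have PE : P = P1 * D by rewrite /P1 divpK ?dvdp_gcdl.
have QE : Q = Q1 * D by rewrite /Q1 divpK ?dvdp_gcdr.
have Q10 : Q1 != 0 by apply: contraNneq q => Q10; rewrite QE Q10 mul0r.
have cop : coprimep P1 Q1 by rewrite coprimep_div_gcd // q orbT.
have f1 : f = P1%:F / Q1%:F.
  rewrite fE; apply/eqP; rewrite fracE //.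
  have -> : P * Q1 = P1 * D * Q1 by rewrite -PE.
  by rewrite mulrAC -mulrA -QE.
(* A root of the reduced denominator at which f has a value would also be a root of the numerator,
   against coprimality. *)
have /size_poly1P[k k0 Q1k] : size Q1 == 1%N.
  apply: contraT => /closed_rootP[a Q1a].
  have [c' [P2 [Q2 [Q2a E _]]]] := freg a.
  move: E; rewrite f1 => /eqP; rewrite fracE ?(horner_neq0 Q2a) // => /eqP.
  move/(congr1 (fun R : {poly K} => R.[a])); rewrite !hornerE (rootP Q1a) mulr0.
  move/eqP.
  rewrite mulf_eq0 (negPf Q2a) orbF => P1a.
  by have := coprimep_root cop P1a; rewrite (rootP Q1a) eqxx.
have fP : f = (k^-1 *: P1)%:F.
  rewrite f1 Q1k -mul_polyC rmorphM mulrC; congr (_ * _).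
  by rewrite -/(scal k) -fmorphV.
have [P2 [Q2 [Q20 sP2 E _]]] := foo.
have sz : (size (k^-1 *: P1) <= 1)%N.
  have E' : k^-1 *: P1 * Q2 = P2.
    apply/eqP; rewrite -tofrac_eq rmorphM /= -fP E mulfVK ?tofrac_eq0 //.
  have [->|nz] := eqVneq (k^-1 *: P1) 0; first by rewrite size_poly0.
  move: sP2; rewrite -E' (size_mul nz Q20) (size_predS Q20) addnS.
  by rewrite -[X in (_ <= X)%N]add1n leq_add2r.
move: fP; rewrite [k^-1 *: P1]size1_polyC // => fP; rewrite fP -/(scal _).
congr scal; apply: value_oo_inj foo; rewrite fP; exact: value_oo_scal.
Qed.

(* [local_coord p i] is [coord_fun (p i)]. *)
Definition coord_fun (q : K) : {fraction {poly K}} :=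
  (scal q)^-1 * 'X%:F - 1.

(** The values [A] at 0 and [B] at infinity are recorded because these two points become nodes of
    the cycle. *)
Definition regular_off (q : K) f (A B : K) : Prop :=
  [/\ forall a, a != q -> exists c, value_at a f c, value_at 0 f A
    & value_oo f B].

Definition regular_at (q : K) f : Prop := exists c, value_at q f c.

Lemma regular_offD q f g A B A' B' : regular_off q f A B ->
  regular_off q g A' B' -> regular_off q (f + g) (A + A') (B + B').
Proof.
move=> [r0 z0 o0] [r1 z1 o1]; split; [|exact: value_atD|exact: value_ooD].
move=> a aq; have [c fc] := r0 a aq; have [c' gc] := r1 a aq.
by exists (c + c'); apply: value_atD.
Qed.

Lemma regular_offM q f g A B A' B' : regular_off q f A B ->
  regular_off q g A' B' -> regular_off q (f * g) (A * A') (B * B').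
Proof.
move=> [r0 z0 o0] [r1 z1 o1]; split; [|exact: value_atM|exact: value_ooM].
move=> a aq; have [c fc] := r0 a aq; have [c' gc] := r1 a aq.
by exists (c * c'); apply: value_atM.
Qed.

Lemma regular_off_scal q c : regular_off q (scal c) c c.
Proof.
split; [|exact: value_at_scal|exact: value_oo_scal].
by move=> a _; exists c; apply: value_at_scal.
Qed.

Lemma regular_atD q f g : regular_at q f -> regular_at q g ->
  regular_at q (f + g).
Proof. by move=> [c fc] [c' gc]; exists (c + c'); apply: value_atD. Qed.

Lemma regular_atM q f g : regular_at q f -> regular_at q g ->
  regular_at q (f * g).
Proof. by move=> [c fc] [c' gc]; exists (c * c'); apply: value_atM. Qed.

Lemma regular_at_scal q c : regular_at q (scal c).
Proof. by exists c; apply: value_at_scal. Qed.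

Lemma regular_offN q f A B : regular_off q f A B ->
  regular_off q (- f) (- A) (- B).
Proof.
by move=> /(regular_offM (regular_off_scal q (-1))); rewrite rmorphN1 !mulN1r.
Qed.

Lemma regular_offX q f A B m : regular_off q f A B ->
  regular_off q (f ^+ m) (A ^+ m) (B ^+ m).
Proof.
move=> fq; elim: m => [|m IH]; last by rewrite !exprS; apply: regular_offM.
by have := regular_off_scal q 1; rewrite rmorph1.
Qed.

Lemma regular_off_eq q f A B A' B' : regular_off q f A B -> A = A' -> B = B' ->
  regular_off q f A' B'.
Proof. by move=> ? <- <-. Qed.

Lemma regular_off0 q : regular_off q 0 0 0.
Proof. by have := regular_off_scal q 0; rewrite rmorph0. Qed.

Lemma regular_at0 q : regular_at q 0.
Proof. by have := regular_at_scal q 0; rewrite rmorph0. Qed.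

Lemma coord_funE q : coord_fun q = scal q^-1 * 'X%:F - scal 1.
Proof. by rewrite /coord_fun fmorphV rmorph1. Qed.

Lemma value_at_coord_fun q a : value_at a (coord_fun q) (a / q - 1).
Proof.
rewrite coord_funE mulrC; apply: value_atD; last first.
  by rewrite -rmorphN; apply: value_at_scal.
apply: value_atM; last exact: value_at_scal.
by have := value_at_poly a 'X; rewrite hornerX.
Qed.

Lemma coord_fun_fracE q : q != 0 ->
  coord_fun q = ('X - q%:P)%:F / scal q.
Proof.
move=> q0; rewrite /coord_fun rmorphB /= mulrBl -/(scal q) divff 1?mulrC //.
by rewrite fmorph_eq0.
Qed.

Lemma coord_fun_neq0 q : q != 0 -> coord_fun q != 0.
Proof.
move=> q0; rewrite coord_fun_fracE // mulf_neq0 ?invr_eq0 ?fmorph_eq0 //.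
by rewrite tofrac_eq0 polyXsubC_eq0.
Qed.

Lemma regular_off_coordV q : q != 0 -> regular_off q (coord_fun q)^-1 (-1) 0.
Proof.
move=> q0; split.
- move=> a aq; exists (a / q - 1)^-1.
  apply: value_atV; first exact: value_at_coord_fun.
  by rewrite subr_eq0 -[1](divff q0) (inj_eq (mulIf _)) ?invr_eq0.
- have -> : (-1 : K) = (0 / q - 1)^-1 by rewrite mul0r sub0r invrN1.
  apply: value_atV; first exact: value_at_coord_fun.
  by rewrite mul0r sub0r oppr_eq0 oner_eq0.
exists q%:P, ('X - q%:P); rewrite polyXsubC_eq0; split=> //.
- by rewrite size_XsubC (leq_trans (size_polyC_leq1 _)).
- by rewrite coord_fun_fracE // invf_div.
by rewrite size_XsubC coefC mul0r.
Qed.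

Lemma regular_at_coord_fun q : regular_at q (coord_fun q).
Proof. by eexists; apply: value_at_coord_fun. Qed.

(** With the last possible pole removed the function is regular on the whole projective line, hence
    constant. *)
Lemma regular_off_at q f A B : regular_off q f A B -> regular_at q f ->
  f = scal B /\ A = B.
Proof.
move=> [r0 z0 o0] rq; have fE : f = scal B.
  apply: regular_constant o0 => a.
  by have [->//|/r0] := eqVneq a q.
by split=> //; apply: value_at_inj z0 _; rewrite fE; apply: value_at_scal.
Qed.

(** The identity behind [principal_part], over an abstract field: x and y stand for X and X^m, with
    X = z - q, and s for the constant q. *)
Lemma partial_fraction (F : fieldType) (d' n' q' p' u' s x y : F) :
  s != 0 -> q' != 0 -> y != 0 ->
  ((d' * (x * y) + n') * q' + p' * u' * (x * y)) / (q' * y) =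
  n' / y + x / s * (s * (p' * u' / q' + d')).
Proof. by move=> *; field; do ?[apply/andP; split]. Qed.

Lemma principal_part q f : q != 0 -> exists g r A B,
  [/\ f = g + coord_fun q * r, regular_off q g A B & regular_at q r].
Proof.
move=> q0; have [P [Q [Q0 ->]]] := fraction_ex f.
have [m [Q1]] := multiplicity_XsubC Q q; rewrite Q0 /= => Q1q QE.
set X := 'X - q%:P in QE *.
have X0 : X != 0 by rewrite polyXsubC_eq0.
(* The exponent m + 1, one more than the pole order, leaves a factor X in the remainder, so that it
   vanishes at q; the numerator N still has degree at most m, so N / X^m is finite at infinity. *)
have cop : coprimep (X ^+ m.+1) Q1.
  by rewrite coprimep_sym coprimep_expr // coprimep_XsubC.
have /Bezout_eq1_coprimepP[[U T] /= UT] := cop.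
pose D := (P * T) %/ X ^+ m.+1; pose N := (P * T) %% X ^+ m.+1.
have PT : P * T = D * X ^+ m.+1 + N by exact: divp_eq.
have sN : (size N <= size (X ^+ m))%N.
  rewrite -ltnS size_exp_XsubC.
  have := ltn_modpN0 (P * T) (expf_neq0 m.+1 X0).
  by rewrite size_exp_XsubC.
have Q10 : Q1 != 0 by apply: contraNneq Q1q => ->; rewrite root0.
have rN : regular_off q (N%:F / (X ^+ m)%:F) (N.[0] / (X ^+ m).[0])
    (N`_(size (X ^+ m)).-1 / lead_coef (X ^+ m)).
  split.
  - move=> a aq; eexists; apply: value_at_frac.
    by rewrite horner_exp hornerXsubC expf_neq0 // subr_eq0.
  - apply: value_at_frac.
    by rewrite horner_exp hornerXsubC expf_neq0 // sub0r oppr_eq0.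
  by exists N, (X ^+ m); rewrite expf_neq0.
exists (N%:F / (X ^+ m)%:F), (scal q * ((P * U)%:F / Q1%:F + D%:F)).
do 2!eexists; split; [|exact: rN|]; last first.
  apply: regular_atM; first exact: regular_at_scal.
  apply: regular_atD; last by eexists; apply: value_at_poly.
  by eexists; apply: value_at_frac; apply: Q1q.
have nz : [/\ scal q != 0, X%:F != 0, Q1%:F != 0 & (X ^+ m)%:F != 0].
  by rewrite fmorph_eq0 !tofrac_eq0 expf_neq0.
case: nz => n1 n2 n3 n4; rewrite coord_fun_fracE // -/X.
have -> : P%:F = ((D * X ^+ m.+1 + N) * Q1 + P * U * X ^+ m.+1)%:F.
  by rewrite -PT -2!mulrA -mulrDr addrC UT mulr1.
rewrite QE; clearbody X; rewrite exprS !(rmorphD, rmorphM) /=.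
move: n1 n2 n3 n4; rewrite !rmorphXn /=.
move: (D%:F) (X%:F) (N%:F) (Q1%:F) (P%:F) (U%:F) (scal q).
move=> d' x n' q' p' u' s n1 n2 n3; move: (x ^+ m) => y n4.
rewrite (@partial_fraction _ d' n' q' p' u' s x y n1 n3 n4).
by [].
Qed.

End Components.

(** * Functions and cochains on the cycle *)

Section Cycle.
Variables (K : closedFieldType) (n : nat) (p : 'I_n -> K).
Hypothesis hn : (1 < n)%N.
Hypothesis p0 : forall i, p i != 0.
Implicit Types (f g : cycle_fun K n) (x : cycle_point K n) (i j : 'I_n).

Lemma ord_pred_neq i : ord_pred i != i.
Proof.
rewrite -val_eqE /=; have := ltn_ord i.
case: (nat_of_ord i) => [|m] mn; first by rewrite add0n modn_small; lia.
by rewrite addSn /= modnDr modn_small; lia.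
Qed.

Lemma ord_pred_pos j : (0 < j)%N -> nat_of_ord (ord_pred j) = j.-1.
Proof.
have := ltn_ord j; rewrite /=; case: (nat_of_ord j) => [|k] // kn _.
by rewrite addSn /= modnDr modn_small; lia.
Qed.

Lemma stalkO_ext x f g : f =1 g -> stalkO x f -> stalkO x g.
Proof. by move=> /funext ->. Qed.

Lemma stalkO_scal x (c : K) : stalkO x (fun=> scal c).
Proof.
by exists c; split=> [|_]; [exact: value_at_scal | exact: value_oo_scal].
Qed.

Lemma stalkO_add x f g : stalkO x f -> stalkO x g ->
  stalkO x (fun j => f j + g j).
Proof.
move=> [c [fc fo]] [c' [gc go]]; exists (c + c').
by split=> [|x0]; [exact: value_atD | exact: value_ooD (fo x0) (go x0)].
Qed.

Lemma stalkO_mul x f g : stalkO x f -> stalkO x g ->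
  stalkO x (fun j => f j * g j).
Proof.
move=> [c [fc fo]] [c' [gc go]]; exists (c * c').
by split=> [|x0]; [exact: value_atM | exact: value_ooM (fo x0) (go x0)].
Qed.

Lemma stalkO_opp x f : stalkO x f -> stalkO x (fun j => - f j).
Proof.
move=> fx; apply: stalkO_ext (stalkO_mul (stalkO_scal x (-1)) fx) => j.
by rewrite rmorphN1 mulN1r.
Qed.

Lemma stalkO_sub x f g : stalkO x f -> stalkO x g ->
  stalkO x (fun j => f j - g j).
Proof. by move=> fx gx; apply: stalkO_add fx (stalkO_opp gx). Qed.

Lemma stalkO_0 x : stalkO x (fun=> 0).
Proof. by apply: stalkO_ext (stalkO_scal x 0) => j; rewrite rmorph0. Qed.

Lemma stalkO_sum (I : Type) (r : seq I) (P : pred I) (F : I -> cycle_fun K n) x :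
  (forall k, P k -> stalkO x (F k)) ->
  stalkO x (fun j => \sum_(k <- r | P k) F k j).
Proof.
move=> FO; elim: r => [|k r IH].
  by apply: stalkO_ext (stalkO_0 x) => j; rewrite big_nil.
have [Pk|nPk] := boolP (P k).
  by apply: stalkO_ext (stalkO_add (FO k Pk) IH) => j; rewrite big_cons Pk.
by apply: stalkO_ext IH => j; rewrite big_cons (negPf nPk).
Qed.

Lemma marked_neq0 x : marked p x -> x.2 != 0.
Proof. by rewrite /marked => /eqP ->. Qed.

Lemma stalkO_marked x f : marked p x ->
  stalkO x f <-> regular_at (p x.1) (f x.1).
Proof.
move=> xp; have x0 := marked_neq0 xp; move: xp => /eqP xp.
split=> [[c [fc _]]|[c fc]]; first by exists c; rewrite -xp.
by exists c; split=> [|/eqP]; [rewrite xp | rewrite (negPf x0)].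
Qed.

(** Turns regularity off the marked points into conditions on single components plus equality of
    values at the nodes, the form in which all gluing is done. *)
Lemma unmarkedP f : (forall x, ~~ marked p x -> stalkO x f) <->
  exists A B : 'I_n -> K, (forall j, regular_off (p j) (f j) (A j) (B j)) /\
    forall j, A j = B (ord_pred j).
Proof.
split=> [freg|[A [B [fAB AB]]] [i a]]; last first.
  rewrite /marked /= => ap; have [r0 z0 o0] := fAB i.
  have [a0|a0] := eqVneq a 0.
    exists (A i); rewrite a0; split=> // _; rewrite AB.
    by case: (fAB (ord_pred i)).
  have [c fc] := r0 a ap; exists c; split=> //= /eqP.
  by rewrite (negPf a0).
have fz j : stalkO (j, 0) f by apply: freg; rewrite /marked eq_sym.
have [A fA] := choice fz.
(* Infinity on component j is the node at 0 of the next component, so its value is read off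
   there. *)
exists A, (fun j => A (ordS j)); split=> j; last by rewrite ord_predK.
have [fz0 _] := fA j; have [_ fo] := fA (ordS j).
split=> //; last by rewrite -[j in f j]ordSK; apply: fo.
by move=> a ap; have [|c [fc _]] := freg (j, a); [exact: ap | exists c].
Qed.

Lemma markedP f : (forall x, marked p x -> stalkO x f) <->
  forall j, regular_at (p j) (f j).
Proof.
split=> [freg j|freg x xp]; last exact/stalkO_marked.
by have /stalkO_marked := freg (j, p j) (eqxx _); apply; rewrite /marked.
Qed.

(** The function y_j = 1 / x_j. Its values, -1 at 0 and 0 at infinity, drive all the gluing
    computations. *)
Definition pole j : {fraction {poly K}} := (local_coord p j)^-1.

Lemma regular_off_pole j : regular_off (p j) (pole j) (-1) 0.
Proof. exact: regular_off_coordV. Qed.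

Lemma local_coord_neq0 j : local_coord p j != 0.
Proof. exact: coord_fun_neq0. Qed.

Lemma std_sectionE i j : std_section p i j =
  (if j == ord_pred i then 1 + pole j else 0) - (if j == i then pole j else 0).
Proof. by []. Qed.

(** * The normalized trace on cochains, its existence, and gluing around the cycle *)

Section Trace.
Variable tau : cycle_fun K n -> K.
Hypothesis tauP : normalized_trace p tau.

Lemma tau_lin c f g : tau (fun j => scal c * f j + g j) = c * tau f + tau g.
Proof. by case: tauP. Qed.

Lemma tau_add f g : tau (fun j => f j + g j) = tau f + tau g.
Proof.
have := tau_lin 1 f g; rewrite mul1r => <-; congr tau; apply/funext => j.
by rewrite rmorph1 mul1r.
Qed.

Lemma tau_unmarked f : (forall x, ~~ marked p x -> stalkO x f) -> tau f = 0.
Proof. by case: tauP => _ + _ _; apply. Qed.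

Lemma tau_marked f : (forall x, marked p x -> stalkO x f) -> tau f = 0.
Proof. by case: tauP => _ _ + _; apply. Qed.

Lemma tau_pole i : tau (fun j => if j == i then pole j else 0) = 1.
Proof. by case: tauP. Qed.

Lemma tau0 : tau (fun=> 0) = 0.
Proof. by apply: tau_unmarked => x _; apply: stalkO_0. Qed.

Lemma tau_scale c f : tau (fun j => scal c * f j) = c * tau f.
Proof.
have := tau_lin c f (fun=> 0); rewrite tau0 addr0 => <-; congr tau.
by apply/funext => j; rewrite addr0.
Qed.

(* Modulo functions regular off the marked points, pole^2 = - pole. *)
Lemma tau_section_pole i (k u w : 'I_n -> K) :
  tau (fun j => std_section p i j * (scal (k j) * pole j +
    scal (u j) * (pole j ^+ 2 * (1 + pole j)) + scal (w j) * pole j ^+ 3)) =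
  k i + w i.
Proof.
set f := (fun j => _).
rewrite -[RHS]mulr1 -(tau_pole i) -tau_scale.
(* On C_i the section is - y_i and the product has value - (k_i + w_i) at 0, which the subtracted
   multiple of the pole cancels. On the preceding component the factor 1 + y vanishes at 0 and the
   other factor at infinity. So [g] vanishes at every node. *)
pose g j := f j - scal (k i + w i) * (if j == i then pole j else 0).
have -> : f = fun j => g j + scal (k i + w i) * (if j == i then pole j else 0).
  by apply/funext => j; rewrite /g subrK.
rewrite tau_add [X in X + _](_ : _ = 0) ?add0r //; apply: tau_unmarked.
apply/unmarkedP; exists (fun=> 0), (fun=> 0); split=> // j.
have ry := regular_off_pole j.
have rc c : regular_off (p j) (scal c) c c by exact: regular_off_scal.
have r1 : regular_off (p j) 1 1 1 by have := rc 1; rewrite rmorph1.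
have body : regular_off (p j) (scal (k j) * pole j +
    scal (u j) * (pole j ^+ 2 * (1 + pole j)) + scal (w j) * pole j ^+ 3)
  (k j * (-1) + u j * ((-1) ^+ 2 * (1 + -1)) + w j * (-1) ^+ 3)
  (k j * 0 + u j * (0 ^+ 2 * (1 + 0)) + w j * 0 ^+ 3).
  by repeat first [apply: regular_offD | apply: regular_offM |
    apply: regular_offX | exact: rc | exact: ry | exact: r1].
rewrite /g /f std_sectionE; have [ji|ji] := eqVneq j i.
  subst j; rewrite eq_sym (negPf (ord_pred_neq i)) sub0r.
  apply: regular_off_eq (regular_offD (regular_offM (regular_offN ry) body)
    (regular_offN (regular_offM (rc (k i + w i)) ry))) _ _; ring.
rewrite mulr0 !subr0; case: ifP => _; last first.
  by rewrite mul0r; apply: regular_off0.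
apply: regular_off_eq (regular_offM (regular_offD r1 ry) body) _ _; ring.
Qed.

End Trace.

(* [c] is the residue at [q] of [f dz / z]: for the principal part [s] it is
   [s(oo) - s(0)], by the residue theorem on the projective line. *)
Definition is_residue (q : K) (h : {fraction {poly K}}) (c : K) : Prop :=
  exists s r A B, [/\ h = s + r, regular_off q s A B, regular_at q r
    & c = B - A].

Lemma is_residue_lin q c h h' a a' : is_residue q h a -> is_residue q h' a' ->
  is_residue q (scal c * h + h') (c * a + a').
Proof.
move=> [g [r [A [B [-> gq rq ->]]]]] [g' [r' [A' [B' [-> gq' rq' ->]]]]].
exists (scal c * g + g'), (scal c * r + r'), (c * A + A'), (c * B + B').
split.
- by rewrite mulrDr addrACA.
- by apply: regular_offD gq'; apply: regular_offM gq; apply: regular_off_scal.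
- by apply: regular_atD rq'; apply: regular_atM rq; apply: regular_at_scal.
by ring.
Qed.

(** The difference of two principal parts of one function has no pole, so it is constant and its
    values at 0 and infinity agree. *)
Lemma is_residue_inj q h a a' : is_residue q h a -> is_residue q h a' -> a = a'.
Proof.
move=> ha ha'; have := is_residue_lin (-1) ha' ha.
rewrite rmorphN1 mulN1r addNr => -[g [r [A [B [gr gq rq E]]]]].
have gr' : g = scal (-1) * r.
  by apply/eqP; rewrite rmorphN1 mulN1r -addr_eq0 -gr.
have [] := regular_off_at gq; first rewrite gr'.
  by apply: regular_atM rq; apply: regular_at_scal.
move=> _ AB; apply/eqP; rewrite -subr_eq0; apply/eqP; move: E.
by rewrite AB subrr mulN1r addrC.
Qed.

Lemma is_residue_ex q h : q != 0 -> exists c, is_residue q h c.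
Proof.
move=> /principal_part-/(_ h)[g [r [A [B [-> gq rq]]]]].
exists (B - A), g, (coord_fun q * r), A, B; split=> //.
by apply: regular_atM rq; apply: regular_at_coord_fun.
Qed.

(** The trace is the sum of the residues at the marked points. On functions regular elsewhere it is
    the sum of the B_j - A_j, which telescopes around the cycle; on 1 / x_i it is 0 - (-1) = 1. *)
Lemma normalized_trace_ex : exists tau, normalized_trace p tau.
Proof.
have /choice[res resP] (qh : 'I_n * {fraction {poly K}}) :
    exists c, is_residue (p qh.1) qh.2 c by exact: is_residue_ex.
have resE j h c : is_residue (p j) h c -> res (j, h) = c.
  exact/is_residue_inj/(resP (j, h)).
exists (fun f => \sum_j res (j, f j)); split.
- move=> c f g; rewrite mulr_sumr -big_split; apply: eq_bigr => j _ /=.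
  by apply: resE; apply: is_residue_lin; [exact: (resP (_, _))..].
- move=> f /unmarkedP[A [B [fAB AB]]].
  transitivity (\sum_j (B j - A j)).
    apply: eq_bigr => j _; apply: resE; exists (f j), 0, (A j), (B j).
    by split; rewrite ?addr0 //; apply: regular_at0.
  rewrite sumrB (reindex_inj (@ord_pred_inj n)) /=.
  by rewrite -sumrB big1 // => j _; rewrite AB subrr.
- move=> f /markedP fp; rewrite big1 // => j _; apply: resE.
  exists 0, (f j), 0, 0; split; rewrite ?add0r ?oppr0 //.
  exact: regular_off0.
move=> i; rewrite (bigD1 i) //= eqxx big1 => [|j /negPf ->].
  rewrite addr0; apply: resE; exists (pole i), 0, (-1), 0.
  split; [by rewrite addr0 | exact: regular_off_pole | | by rewrite opprK add0r].
  exact: regular_at0.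
apply: resE; exists 0, 0, 0, 0; rewrite addr0 subrr.
by split=> //; [exact: regular_off0 | exact: regular_at0].
Qed.

(* H^0(C, O_C) = K, in the form of a recursion around the cycle. *)
Lemma glue f (u w : 'I_n -> K) :
  (forall x, ~~ marked p x -> stalkO x f) ->
  (forall j, regular_at (p j)
    (f j + (scal (u j) * (pole j + pole j ^+ 2) - scal (w j) * pole j ^+ 2))) ->
  exists c, forall j, f j = scal (c - \sum_(m < n | (m <= j)%N) w m) -
    (scal (u j) * (pole j + pole j ^+ 2) - scal (w j) * pole j ^+ 2).
Proof.
move=> /unmarkedP[A [B [fAB AB]]] freg.
have ry := regular_off_pole.
have rc j c : regular_off (p j) (scal c) c c by exact: regular_off_scal.
have rb j : regular_off (p j)
    (scal (u j) * (pole j + pole j ^+ 2) - scal (w j) * pole j ^+ 2)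
    (u j * (-1 + (-1) ^+ 2) - w j * (-1) ^+ 2)
    (u j * (0 + 0 ^+ 2) - w j * 0 ^+ 2).
  by repeat first [apply: regular_offD | apply: regular_offM |
    apply: regular_offN | apply: regular_offX | exact: rc | exact: ry].
(* The corrected function has no pole, so it is the constant [B j]; comparing values at 0 gives the
   jump [w j]. *)
have cE j : f j + (scal (u j) * (pole j + pole j ^+ 2)
    - scal (w j) * pole j ^+ 2) = scal (B j) /\ A j = B j + w j.
  have [-> E] := regular_off_at (regular_offD (fAB j) (rb j)) (freg j).
  split; first by congr scal; ring.
  apply: (addIr (u j * (-1 + (-1) ^+ 2) - w j * (-1) ^+ 2)); rewrite E; ring.
(* The value at the node before component 0; each component passed lowers it by its [w]. *)
pose c := B (ord_pred (Ordinal (ltnW hn))).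
exists c => j; have [fE _] := cE j.
rewrite -[LHS](addrK (scal (u j) * (pole j + pole j ^+ 2)
    - scal (w j) * pole j ^+ 2)) fE; congr (scal _ - _).
have [m jm] := ubnP (j : nat); elim: m j jm {fE} => // m IH j jm.
have Bj : B j = B (ord_pred j) - w j.
  by have [_ E] := cE j; rewrite -AB E addrK.
rewrite (bigD1 j) //=.
have [j0|j0] := posnP j.
  have -> : c = B (ord_pred j).
    by rewrite /c; congr (B (ord_pred _)); apply: val_inj.
  rewrite big1 ?addr0 // => k.
  by rewrite -val_eqE /=; lia.
rewrite Bj IH ord_pred_pos //; last by lia.
rewrite -addrA -opprD; congr (c - _); rewrite addrC; congr (_ + _).
by apply: eq_bigl => k; rewrite -val_eqE /=; lia.
Qed.

(* The compatibility at the last node is the condition on the sum of [w]. *)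
Lemma glue_ex (u w : 'I_n -> K) : \sum_j w j = 0 ->
  forall x, ~~ marked p x -> stalkO x (fun j =>
    scal (- \sum_(m < n | (m <= j)%N) w m) -
    (scal (u j) * (pole j + pole j ^+ 2) - scal (w j) * pole j ^+ 2)).
Proof.
move=> w0; apply/unmarkedP.
exists (fun j => - \sum_(m < n | (m < j)%N) w m).
exists (fun j => - \sum_(m < n | (m <= j)%N) w m).
have ry := regular_off_pole.
have rc j c : regular_off (p j) (scal c) c c by exact: regular_off_scal.
split=> j; last first.
  congr (- _); have [j0|j0] := posnP j; last first.
    by apply: eq_bigl => k; rewrite ord_pred_pos //; lia.
  (* At j = 0 the preceding component is the last one, where the partial sum is the full sum of [w],
     hence 0. *)
  rewrite big1 => [|k]; last by rewrite j0.
  rewrite -[LHS]w0; apply: eq_bigl => k.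
  rewrite /= j0 add0n modn_small; last by lia.
  by have := ltn_ord k; lia.
have E : \sum_(m < n | (m <= j)%N) w m = w j + \sum_(m < n | (m < j)%N) w m.
  rewrite (bigD1 j) //=; congr (_ + _); apply: eq_bigl => m.
  by rewrite -val_eqE /=; lia.
apply: (@regular_off_eq _ _ _
    (- \sum_(m < n | (m <= j)%N) w m -
      (u j * (-1 + (-1) ^+ 2) - w j * (-1) ^+ 2))
    (- \sum_(m < n | (m <= j)%N) w m - (u j * (0 + 0 ^+ 2) - w j * 0 ^+ 2))).
- by repeat first [apply: regular_offD | apply: regular_offM |
    apply: regular_offN | apply: regular_offX | exact: rc | exact: ry].
- rewrite E; ring.
by ring.
Qed.
End Cycle.

(** * Ring identities for the cochains of the connecting map *)

(** For xi = x0 + r1 + r2 the result has three groups: the polar main term, a term built from r1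
    that will be regular off the marked points, and a term with regular coefficients times r2. *)
Lemma cochain_splitting (F : comPzRingType) (I : finType)
    (al S x0 r1 r2 : I -> F) (dl x0l r1l r2l : F) :
  \sum_k (al k - S k * r1l) * (x0 k + r1 k + r2 k) +
  (\sum_k S k * (x0 k + r1 k + r2 k) - (dl + \sum_k S k * r1 k)) *
    (x0l + r1l + r2l) =
  (\sum_k al k * x0 k + (\sum_k S k * x0 k - dl) * x0l) +
  (\sum_k al k * r1 k - (\sum_k S k * r1 k + dl) * r1l) +
  (\sum_k (al k + S k * x0l) * r2 k +
    (\sum_k S k * x0 k - dl + \sum_k S k * r2 k) * r2l).
Proof.
have E1 : \sum_k (al k - S k * r1l) * (x0 k + r1 k + r2 k) =
    \sum_k al k * x0 k + \sum_k al k * r1 k + \sum_k al k * r2 k -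
    (\sum_k S k * x0 k + \sum_k S k * r1 k + \sum_k S k * r2 k) * r1l.
  rewrite -!big_split mulr_suml -sumrB; apply: eq_bigr => k _ /=; ring.
have E2 : \sum_k S k * (x0 k + r1 k + r2 k) =
    \sum_k S k * x0 k + \sum_k S k * r1 k + \sum_k S k * r2 k.
  rewrite -!big_split; apply: eq_bigr => k _ /=; ring.
have E3 : \sum_k (al k + S k * x0l) * r2 k =
    \sum_k al k * r2 k + (\sum_k S k * r2 k) * x0l.
  rewrite mulr_suml -!big_split; apply: eq_bigr => k _ /=; ring.
rewrite E1 E2 E3; ring.
Qed.

(** Brings the main term to the three shapes y, y^2 (1 + y) and y^3 that [tau_section_pole]
    evaluates. *)
Lemma cochain_normal (F : comPzRingType) (I : finType)
    (C ph A A' : I -> F) (y phl E : F) :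
  let S k := A' k * (1 + y) - A k * y in
  \sum_k (C k - S k * (phl * y)) * (ph k * y) + E * (phl * y) =
  (\sum_k ph k * C k + E * phl) * y +
  - (phl * \sum_k ph k * A' k) * (y ^+ 2 * (1 + y)) +
  (phl * \sum_k ph k * A k) * y ^+ 3.
Proof.
move=> S.
have -> : \sum_k (C k - S k * (phl * y)) * (ph k * y) =
    (\sum_k ph k * C k) * y - phl * y ^+ 2 * ((\sum_k ph k * A' k) * (1 + y) -
    (\sum_k ph k * A k) * y).
  rewrite !mulr_suml -sumrB mulr_sumr -sumrB; apply: eq_bigr => k _.
  rewrite /S; ring.
ring.
Qed.

Lemma section_pole (F : comPzRingType) (a' a ph y : F) :
  (a' * (1 + y) - a * y) * (ph * y) =
  ph * a' * (y + y ^+ 2) - ph * a * y ^+ 2.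
Proof. ring. Qed.

Lemma cochain_difference (F : comPzRingType) (g1 g2 k u w y v U M : F) :
  g1 - g2 = - k * y + u * v + - w * y ^+ 3 + (g1 - U) +
    - (M + (g2 - (k * y + - u * v + w * y ^+ 3 + U + M))).
Proof. ring. Qed.

(** * Sections and cochains of L^dual, and the value of the connecting map *)

Section Calc.
Variables (K : closedFieldType) (n : nat) (p : 'I_n -> K).
Hypothesis hn : (1 < n)%N.
Hypothesis p0 : forall i, p i != 0.
Implicit Types (f g : cycle_fun K n) (x : cycle_point K n) (i j : 'I_n).

Lemma regular_at_sum (I : Type) (r : seq I) (P : pred I) q
    (F : I -> {fraction {poly K}}) :
  (forall k, P k -> regular_at q (F k)) ->
  regular_at q (\sum_(k <- r | P k) F k).
Proof.
move=> FO; elim/big_rec: _ => [|k h Pk IH]; first exact: regular_at0.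
exact: regular_atD (FO k Pk) IH.
Qed.

Lemma regular_atN q (h : {fraction {poly K}}) :
  regular_at q h -> regular_at q (- h).
Proof.
by move=> hq; rewrite -mulN1r -(rmorphN1 (@scal K)); apply: regular_atM hq;
  apply: regular_at_scal.
Qed.

(* The cochains [pole j] on the [j]-th component represent the basis of
   H^1(L^dual) dual to the standard sections. *)
Lemma cochain_decomposition f : exists (c : 'I_n -> K) (r1 r2 : cycle_fun K n),
  [/\ forall j, f j = scal (c j) * pole p j + r1 j + r2 j,
      forall x, ~~ marked p x -> stalkO x r1 &
      forall j, regular_at (p j) (pole p j * r2 j)].
Proof.
have /choice[dec decP] j : exists gr : {fraction {poly K}} * {fraction {poly K}},
    exists AB : K * K, [/\ f j = gr.1 + local_coord p j * gr.2,
      regular_off (p j) gr.1 AB.1 AB.2 & regular_at (p j) gr.2].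
  have [g [r [A [B ?]]]] := principal_part (f j) (p0 j).
  by exists (g, r), (A, B).
have {decP}/choice[AB ABP] := decP.
(* The mismatch of the principal parts at the node before C_j. Subtracting this multiple of
   [pole j], which is -1 at 0 and 0 at infinity, repairs it without disturbing the next node. *)
pose c j := (AB (ord_pred j)).2 - (AB j).1.
exists c, (fun j => (dec j).1 - scal (c j) * pole p j),
  (fun j => local_coord p j * (dec j).2); split.
- by move=> j; rewrite [scal _ * _ + _]addrC subrK; case: (ABP j).
- apply/(unmarkedP p0).
  exists (fun j => (AB (ord_pred j)).2), (fun j => (AB j).2); split=> // j.
  have [_ gAB _] := ABP j.
  apply: regular_off_eq (regular_offD gAB (regular_offN (regular_offM
    (regular_off_scal _ (c j)) (regular_off_pole p0 j)))) _ _; rewrite /c; ring.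
move=> j; rewrite mulKf ?local_coord_neq0 //; by case: (ABP j).
Qed.

(** The section s_i has value 1 at the node joining C_(i-1) to C_i and 0 at all other nodes. *)
Lemma unmarked_section i x : ~~ marked p x -> stalkO x (std_section p i).
Proof.
move: x; apply/(unmarkedP p0).
exists (fun j => (j == i)%:R), (fun j => (j == ord_pred i)%:R).
split=> [j|j]; last by rewrite (inj_eq (@ord_pred_inj n)).
rewrite std_sectionE.
have ry := regular_off_pole p0 j.
have r0 := regular_off0 (p j).
have r1 : regular_off (p j) 1 1 1.
  by have := regular_off_scal (p j) 1; rewrite rmorph1.
have [ji|ji] := eqVneq j i.
  subst j; rewrite ![i == ord_pred i]eq_sym (negPf (ord_pred_neq hn i)).
  by apply: regular_off_eq (regular_offD r0 (regular_offN ry)) _ _ => /=; ring.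
have [_|_] := eqVneq j (ord_pred i).
  by apply: regular_off_eq (regular_offD (regular_offD r1 ry)
    (regular_offN r0)) _ _ => /=; ring.
by apply: regular_off_eq (regular_offD r0 (regular_offN r0)) _ _ => /=; ring.
Qed.

Lemma marked_section i j :
  regular_at (p j) (local_coord p j * std_section p i j).
Proof.
have nz := local_coord_neq0 p0 j.
have rx : regular_at (p j) (local_coord p j) by exact: regular_at_coord_fun.
have r1 : regular_at (p j) 1.
  by have := regular_at_scal (p j) 1; rewrite rmorph1.
rewrite std_sectionE mulrBr; apply: regular_atD; last apply: regular_atN.
  case: ifP => _; last by rewrite mulr0; apply: regular_at0.
  by rewrite mulrDr mulr1 divff //; apply: regular_atD.
by case: ifP => _; [rewrite divff | rewrite mulr0; apply: regular_at0].
Qed.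

(** Only s_j and s_(j+1) are nonzero on C_j. *)
Lemma section_comb (a : 'I_n -> K) j :
  \sum_i scal (a i) * std_section p i j =
  scal (a (ordS j)) * (1 + pole p j) - scal (a j) * pole p j.
Proof.
under eq_bigr do rewrite std_sectionE mulrBr.
rewrite sumrB; congr (_ - _).
  rewrite (bigD1 (ordS j)) //= ordSK eqxx big1 ?addr0 // => i ij.
  case: eqP => [E|_]; last by rewrite mulr0.
  by rewrite E ord_predK eqxx in ij.
rewrite (bigD1 j) //= eqxx big1 ?addr0 // => i ij.
by rewrite eq_sym (negPf ij) mulr0.
Qed.

Variable tau : cycle_fun K n -> K.
Hypothesis tauP : normalized_trace p tau.

Lemma tau_section_unmarked i f : (forall x, ~~ marked p x -> stalkO x f) ->
  tau (fun j => std_section p i j * f j) = 0.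
Proof.
move=> fO; apply: (tau_unmarked tauP) => x xp.
by apply: stalkO_mul (fO x xp); apply: unmarked_section.
Qed.

Lemma tau_section_marked i f :
  (forall j, regular_at (p j) (pole p j * f j)) ->
  tau (fun j => std_section p i j * f j) = 0.
Proof.
move=> fO; apply: (tau_marked tauP); apply/(markedP p0) => j.
rewrite -[f j](mulVKf (local_coord_neq0 p0 j)) mulrCA mulrA.
by apply: regular_atM (fO j); apply: marked_section.
Qed.

Lemma tau_section_decomposition i f (k u w : 'I_n -> K)
    (r1 r2 : cycle_fun K n) :
  (forall j, f j = scal (k j) * pole p j +
     scal (u j) * (pole p j ^+ 2 * (1 + pole p j)) +
     scal (w j) * pole p j ^+ 3 + r1 j + r2 j) ->
  (forall x, ~~ marked p x -> stalkO x r1) ->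
  (forall j, regular_at (p j) (pole p j * r2 j)) ->
  tau (fun j => std_section p i j * f j) = k i + w i.
Proof.
move=> fE r1O r2O.
have -> : (fun j => std_section p i j * f j) = (fun j =>
    std_section p i j * (scal (k j) * pole p j + scal (u j) *
      (pole p j ^+ 2 * (1 + pole p j)) + scal (w j) * pole p j ^+ 3) +
    std_section p i j * r1 j + std_section p i j * r2 j).
  by apply/funext => j; rewrite fE -!mulrDr.
rewrite !(tau_add tauP) (tau_section_pole hn p0 tauP).
by rewrite tau_section_unmarked // tau_section_marked // !addr0.
Qed.

Lemma tau_section_dual i f (k : 'I_n -> K) (r1 r2 : cycle_fun K n) :
  (forall j, f j = scal (k j) * pole p j + r1 j + r2 j) ->
  (forall x, ~~ marked p x -> stalkO x r1) ->
  (forall j, regular_at (p j) (pole p j * r2 j)) ->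
  tau (fun j => std_section p i j * f j) = k i.
Proof.
move=> fE r1O r2O; rewrite -[RHS]addr0.
apply: (tau_section_decomposition (k := k) (u := fun=> 0) (w := fun=> 0) i _
  r1O r2O) => j.
by rewrite fE !rmorph0 !mul0r !addr0.
Qed.

(* [xi], [gam1], [gam2] stand for the cochains of L^dual multiplied by [theta].
   The conclusion computes the connecting map modulo [phi(W)]. *)
Lemma connecting_map_formula (d : nat) (phi : 'I_n -> 'I_d -> K)
    (a : 'I_d -> 'I_n -> K) (xi gam1 gam2 : 'I_d -> cycle_fun K n)
    (al : 'I_d -> 'I_d -> cycle_fun K n) (dl : cycle_fun K n) :
  let S k j := \sum_i scal (a k i) * std_section p i j in
  (forall l i, tau (fun j => std_section p i j * xi l j) = phi i l) ->
  (forall k l x, ~~ marked p x -> stalkO x (al k l)) ->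
  (forall k l j, regular_at (p j) (al k l j + S k j * xi l j)) ->
  (forall x, ~~ marked p x -> stalkO x dl) ->
  (forall j, regular_at (p j) (dl j - \sum_k S k j * xi k j)) ->
  (forall l x, ~~ marked p x -> stalkO x (gam1 l)) ->
  (forall l j, regular_at (p j) (pole p j * (gam2 l j -
     (\sum_k al k l j * xi k j + (\sum_k S k j * xi k j - dl j) * xi l j)))) ->
  exists (c : 'I_d -> 'I_d -> K) (e : K), forall i l,
    tau (fun j => std_section p i j * (gam1 l j - gam2 l j)) =
    \sum_k phi i k * (\sum_(m < n | (m <= i)%N) a k m * phi m l) +
    phi i l * (\sum_(m < n | (m < i)%N) \sum_k phi m k * a k m) -
    (\sum_k phi i k * c k l + phi i l * e).
Proof.
move=> S xiP alU alM dlU dlM g1U g2M.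
have SE k j : S k j =
    scal (a k (ordS j)) * (1 + pole p j) - scal (a k j) * pole p j.
  exact: section_comb.
have SU k x : ~~ marked p x -> stalkO x (S k).
  move=> xp; apply: stalkO_sum => i _.
  by apply: stalkO_mul; [exact: stalkO_scal | exact: unmarked_section].
have SM k j : regular_at (p j) (local_coord p j * S k j).
  rewrite /S mulr_sumr; apply: regular_at_sum => i _; rewrite mulrCA.
  by apply: regular_atM; [exact: regular_at_scal | exact: marked_section].
have /choice[c0 /choice[r1 /choice[r2 xiD]]] :=
  fun l : 'I_d => cochain_decomposition (xi l).
have c0E l i : c0 l i = phi i l.
  by case: (xiD l) => E U M; rewrite -(tau_section_dual i E U M) xiP.
pose x0 l j := scal (phi j l) * pole p j.
have xiE l j : xi l j = x0 l j + r1 l j + r2 l j.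
  by rewrite /x0 -c0E; case: (xiD l) => E _ _; rewrite E.
have r1U l x : ~~ marked p x -> stalkO x (r1 l).
  by case: (xiD l) => _ U _; apply: U.
have r2M l j : regular_at (p j) (pole p j * r2 l j).
  by case: (xiD l).
have Sr2M k l j : regular_at (p j) (S k j * r2 l j).
  rewrite -[r2 l j](mulVKf (local_coord_neq0 p0 j)) mulrCA mulrA.
  exact: regular_atM (SM k j) (r2M l j).
(* Absorbing [r1] keeps regularity off the marked points and replaces [xi] by its polar part [x0] in
   the conditions at the marked points, which is the situation of [glue]. *)
pose al' k l j := al k l j + S k j * r1 l j.
pose dl' j := dl j - \sum_k S k j * r1 k j.
have Sx0 k l j : S k j * x0 l j =
    scal (phi j l * a k (ordS j)) * (pole p j + pole p j ^+ 2) -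
    scal (phi j l * a k j) * pole p j ^+ 2.
  rewrite SE /x0 !rmorphM /=; exact: section_pole.
have alc k l : exists c, forall j, al' k l j =
    scal (c - \sum_(m < n | (m <= j)%N) phi m l * a k m) - S k j * x0 l j.
  have [||c cE] := glue hn p0 (f := al' k l)
      (u := fun j => phi j l * a k (ordS j)) (w := fun j => phi j l * a k j).
  - move=> x xp; apply: stalkO_add (alU k l x xp) _.
    exact: stalkO_mul (SU k x xp) (r1U l x xp).
  - move=> j; rewrite -Sx0 /al'.
    have := regular_atD (alM k l j) (regular_atN (Sr2M k l j)).
    by rewrite xiE !mulrDr addrA addrK addrA addrAC.
  by exists c => j; rewrite cE Sx0.
have /choice[c1 c1P] k : exists c1 : 'I_d -> K, forall l j, al' k l j =
    scal (c1 l - \sum_(m < n | (m <= j)%N) phi m l * a k m) - S k j * x0 l j.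
  by have /choice[c1 c1P] := alc k; exists c1.
pose t m := \sum_k phi m k * a k m.
have sumSx0 j : \sum_k S k j * x0 k j =
    scal (\sum_k phi j k * a k (ordS j)) * (pole p j + pole p j ^+ 2) -
    scal (t j) * pole p j ^+ 2.
  rewrite /t !rmorph_sum !mulr_suml -sumrB.
  by apply: eq_bigr => k _; apply: Sx0.
have [e eE] : exists e, forall j, \sum_k S k j * x0 k j - dl' j =
    scal (e - \sum_(m < n | (m <= j)%N) t m).
  have [||e eE] := glue hn p0 (f := fun j => - dl' j)
      (u := fun j => \sum_k phi j k * a k (ordS j)) (w := t).
  - move=> x xp; apply: stalkO_opp; apply: stalkO_sub (dlU x xp) _.
    by apply: stalkO_sum => k _; apply: stalkO_mul (SU k x xp) (r1U k x xp).
  - move=> j; rewrite -sumSx0.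
    have : regular_at (p j) (\sum_k S k j * r2 k j).
      by apply: regular_at_sum => k _.
    move=> /(regular_atD (dlM j))/regular_atN.
    rewrite (eq_bigr (fun k => S k j * x0 k j + S k j * r1 k j + S k j * r2 k j)).
      rewrite !big_split /=.
      have E (F : comPzRingType) (u v r s : F) :
        - (u - (v + r + s) + s) = - (u - r) + v by ring.
      by rewrite E.
    by move=> k _; rewrite xiE !mulrDr.
  by exists e => j; rewrite addrC eE sumSx0 subrK.
exists c1, e => i l.
(* [C] and [E] are the constants found by gluing; [k0], [- u] and [w] are the coefficients of the
   three shapes, of which only the first and last survive under [tau]. *)
pose C k j := c1 k l - \sum_(m < n | (m <= j)%N) phi m l * a k m.
pose E j := e - \sum_(m < n | (m <= j)%N) t m.
pose k0 j := \sum_k phi j k * C k j + E j * phi j l.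
pose u j := phi j l * \sum_k phi j k * a k (ordS j).
pose w j := phi j l * t j.
(* [U] is regular off the marked points and [M] lies in L^dual (times theta) at them, so neither
   contributes to [tau]. *)
pose U j := \sum_k al' k l j * r1 k j -
  (\sum_k S k j * r1 k j + dl' j) * r1 l j.
pose M j := \sum_k (al' k l j + S k j * x0 l j) * r2 k j +
  (\sum_k S k j * x0 k j - dl' j + \sum_k S k j * r2 k j) * r2 l j.
pose Q j := \sum_k al k l j * xi k j + (\sum_k S k j * xi k j - dl j) * xi l j.
have QE j : Q j = scal (k0 j) * pole p j +
    scal (- u j) * (pole p j ^+ 2 * (1 + pole p j)) +
    scal (w j) * pole p j ^+ 3 + U j + M j.
  transitivity ((\sum_k al' k l j * x0 k j +
      (\sum_k S k j * x0 k j - dl' j) * x0 l j) + U j + M j).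
    rewrite -cochain_splitting /Q; congr (_ + _).
      by apply: eq_bigr => k _; rewrite xiE /al' addrK.
    rewrite -xiE /dl' subrK; congr ((_ - _) * _).
    by apply: eq_bigr => k _; rewrite xiE.
  congr (_ + _ + _).
  have sE (y z : 'I_d -> K) :
    \sum_k scal (y k) * scal (z k) = scal (\sum_k y k * z k).
    by rewrite rmorph_sum; apply: eq_bigr => k _; rewrite rmorphM.
  have N := cochain_normal (fun k => scal (C k j)) (fun k => scal (phi j k))
    (fun k => scal (a k j)) (fun k => scal (a k (ordS j))) (pole p j)
    (scal (phi j l)) (scal (E j)).
  rewrite /= !sE -!rmorphM -rmorphD -rmorphN in N.
  rewrite -N eE; congr (_ + _).
  by apply: eq_bigr => k _; rewrite c1P /C -SE.
have g12E j : gam1 l j - gam2 l j = scal (- k0 j) * pole p j +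
    scal (u j) * (pole p j ^+ 2 * (1 + pole p j)) +
    scal (- w j) * pole p j ^+ 3 + (gam1 l j - U j) +
    - (M j + (gam2 l j - Q j)).
  rewrite QE !rmorphN; exact: cochain_difference.
rewrite (tau_section_decomposition i g12E); first last.
- move=> j; rewrite mulrN mulrDr; apply: regular_atN.
  apply: regular_atD (g2M l j); rewrite /M mulrDr mulr_sumr.
  apply: regular_atD.
    apply: regular_at_sum => k _; rewrite mulrCA; apply: regular_atM (r2M k j).
    by rewrite c1P subrK; apply: regular_at_scal.
  rewrite mulrCA; apply: regular_atM (r2M l j).
  rewrite eE; apply: regular_atD; first exact: regular_at_scal.
  exact: regular_at_sum.
- have al'U k x : ~~ marked p x -> stalkO x (al' k l).
    move=> xp; apply: stalkO_add (alU k l x xp) _.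
    exact: stalkO_mul (SU k x xp) (r1U l x xp).
  have Sr1U x : ~~ marked p x -> stalkO x (fun j => \sum_k S k j * r1 k j).
    move=> xp; apply: stalkO_sum => k _.
    exact: stalkO_mul (SU k x xp) (r1U k x xp).
  move=> x xp; apply: stalkO_sub (g1U l x xp) _; apply: stalkO_sub.
    by apply: stalkO_sum => k _; apply: stalkO_mul (al'U k x xp) (r1U k x xp).
  apply: stalkO_mul (r1U l x xp); apply: stalkO_add (Sr1U x xp) _.
  exact: stalkO_sub (dlU x xp) (Sr1U x xp).
rewrite /k0 /w /C /E.
(* The coefficient of y^3 cancels the summand m = i, which makes the second sum of the formula
   strict. *)
have -> : \sum_(m < n | (m <= i)%N) t m =
    t i + \sum_(m < n | (m < i)%N) t m.
  rewrite (bigD1 i) //=; congr (_ + _); apply: eq_bigl => m.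
  by rewrite -val_eqE /=; lia.
under [in LHS]eq_bigr do rewrite mulrBr.
rewrite sumrB -/(t _).
have -> : \sum_k phi i k * (\sum_(m < n | (m <= i)%N) phi m l * a k m) =
    \sum_k phi i k * (\sum_(m < n | (m <= i)%N) a k m * phi m l).
  apply: eq_bigr => k _; congr (_ * _).
  by apply: eq_bigr => m _; rewrite mulrC.
rewrite -/t; ring.
Qed.

End Calc.

(** * Homomorphisms from the endomorphism bundle *)

Section DeltaBlock.
Variables (R : pzSemiRingType) (m : nat).

Lemma delta_block_ul (k l : 'I_m) :
  delta_mx (lshift 1 k) (lshift 1 l) = block_mx (delta_mx k l) 0 0 0 :>
    'M[R]_(m + 1).
Proof. by rewrite /block_mx delta_mx_ushift delta_mx_lshift row_mx0. Qed.

Lemma delta_block_ur (k : 'I_m) :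
  delta_mx (lshift 1 k) (rshift m 0) = block_mx 0 (delta_mx k 0) 0 0 :>
    'M[R]_(m + 1).
Proof. by rewrite /block_mx delta_mx_ushift delta_mx_rshift row_mx0. Qed.

Lemma delta_block_dl (l : 'I_m) :
  delta_mx (rshift m 0) (lshift 1 l) = block_mx 0 0 (delta_mx 0 l) 0 :>
    'M[R]_(m + 1).
Proof. by rewrite /block_mx delta_mx_dshift delta_mx_lshift row_mx0. Qed.

Lemma delta_block_dr :
  delta_mx (rshift m 0) (rshift m 0) = block_mx 0 0 0 (delta_mx 0 0) :>
    'M[R]_(m + 1).
Proof. by rewrite /block_mx delta_mx_dshift delta_mx_rshift row_mx0. Qed.

End DeltaBlock.

Section Frames.
Variables (K : closedFieldType) (n d : nat) (p : 'I_n -> K).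
Hypothesis p0 : forall i, p i != 0.
Variables (L : cycle_sheaf K n) (theta : cycle_fun K n).
Hypothesis Ltheta : iso_by theta (O_marked p) L.
Variable xi : 'I_d -> cycle_fun K n.
Implicit Types (f g : cycle_fun K n) (x : cycle_point K n) (j : 'I_n).
Local Notation FF := {fraction {poly K}}.

(** A local generator of L at x, transported by [theta] from one of O_C(sum p_i). *)
Definition generator x j : FF :=
  theta j * (if marked p x && (j == x.1) then pole p j else 1).

(** The generic trivialization is the splitting over U1, so the cochain is felt only at the marked
    points. *)
Definition local_xi x k j : FF := if marked p x then xi k j else 0.

Lemma generator_neq0 x j : generator x j != 0.
Proof.
rewrite mulf_neq0 //; first by case: Ltheta.
by case: ifP => _; rewrite ?oner_eq0 // invr_eq0 local_coord_neq0.
Qed.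

Lemma line_bundle_stalk x f :
  L x f <-> stalkO x (fun j => (generator x j)^-1 * f j).
Proof.
have [th0 ->] := Ltheta.
have invE j y : (generator x j)^-1 * y =
    (if marked p x && (j == x.1) then local_coord p j else 1) *
    ((theta j)^-1 * y).
  rewrite /generator invfM -mulrA mulrCA; congr (_ * _).
  by case: ifP => _; rewrite ?invr1 // invrK.
split=> [[u ux ->]|fx].
  by apply: stalkO_ext ux => j; rewrite invE mulKf.
exists (fun j => (theta j)^-1 * f j).
  by apply: stalkO_ext fx => j; rewrite invE.
by apply/funext => j; rewrite mulVKf.
Qed.

(* In this basis the stalk of E at [x] is O_x^(d+1). *)
Definition frame x j : 'M[FF]_(d + 1) :=
  block_mx 1%:M (\col_k - (local_xi x k j * generator x j)) 0 (generator x j)%:M.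

Definition coframe x j : 'M[FF]_(d + 1) :=
  block_mx 1%:M (\col_k local_xi x k j) 0 ((generator x j)^-1)%:M.

Lemma frameK x j : coframe x j *m frame x j = 1%:M.
Proof.
rewrite mulmx_block !mul0mx !mulmx0 !mul1mx !addr0 add0r -scalar_mxM.
rewrite mulVf ?generator_neq0 // [RHS]scalar_mx_block; congr block_mx.
by apply/colP => k; rewrite !mxE big_ord1 !mxE eqxx mulr1n addNr.
Qed.

Lemma coframeK x j : frame x j *m coframe x j = 1%:M.
Proof. exact: mulmx1C (frameK x j). Qed.

Lemma stalkE_coframe x v :
  stalkE p L xi x v <->
  forall a, stalkO x (fun j => (coframe x j *m v j) a 0).
Proof.
have coE j : coframe x j *m v j =
    col_mx (usubmx (v j) + (\col_k local_xi x k j) *m dsubmx (v j))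
      ((generator x j)^-1%:M *m dsubmx (v j)).
  by rewrite -[in LHS](vsubmxK (v j)) mul_block_col mul1mx mul0mx add0r.
have topE k j : (coframe x j *m v j) (lshift 1 k) 0 = usubmx (v j) k 0 +
    (if marked p x then dsubmx (v j) 0 0 * xi k j else 0).
  rewrite coE col_mxEu mxE; congr (_ + _).
  rewrite !mxE big_ord1 !mxE /local_xi.
  by case: ifP => _; rewrite ?mul0r // mulrC.
have botE j : (coframe x j *m v j) (rshift d 0) 0 =
    (generator x j)^-1 * dsubmx (v j) 0 0.
  by rewrite coE col_mxEd mul_scalar_mx mxE.
split=> [[vL vO] a|va].
  case: (split_ordP a) => k ->.
    by apply: stalkO_ext (vO k) => j; rewrite topE.
  have /line_bundle_stalk := vL; apply: stalkO_ext => j.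
  by rewrite ord1 botE.
split; first by apply/line_bundle_stalk; apply: stalkO_ext (va (rshift d 0)).
by move=> k; apply: stalkO_ext (va (lshift 1 k)).
Qed.

(** In the frame the stalk of E is free over O_x, so its endomorphisms are the matrices with entries
    in O_x. *)
Lemma stalkEndE_frame x M :
  stalkEndE p L xi x M <->
  forall a b, stalkO x (fun j => (coframe x j *m M j *m frame x j) a b).
Proof.
split=> [Mx a b|Mx v /stalkE_coframe vx]; last first.
  apply/stalkE_coframe => a.
  apply: (stalkO_ext (f := fun j => \sum_b
      (coframe x j *m M j *m frame x j) a b * (coframe x j *m v j) b 0)).
    move=> j; rewrite -[in RHS](mul1mx (v j)) -(coframeK x j) !mulmxA.
    by rewrite -2!mulmxA mulmxA [RHS]mxE.
  by apply: stalkO_sum => b _; apply: stalkO_mul.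
have bx : stalkE p L xi x (fun j => frame x j *m delta_mx b 0).
  apply/stalkE_coframe => c.
  apply: stalkO_ext (stalkO_scal x (c == b)%:R) => j.
  by rewrite mulmxA frameK mul1mx mxE andbT rmorph_nat.
have /stalkE_coframe/(_ a) := Mx _ bx; apply: stalkO_ext => j.
rewrite !mulmxA -colE; exact: mxE.
Qed.

Lemma functional_sum_delta (h : {scalar 'M[FF]_(d + 1)}) M :
  h M = \sum_a \sum_b M a b * h (delta_mx a b).
Proof.
rewrite {1}(matrix_sum_delta M) linear_sum; apply: eq_bigr => a _.
by rewrite linear_sum; apply: eq_bigr => b _; rewrite linearZ.
Qed.

Lemma functional_frame (h : {scalar 'M[FF]_(d + 1)}) x j M :
  h M = \sum_a \sum_b (coframe x j *m M *m frame x j) a b *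
    h (frame x j *m delta_mx a b *m coframe x j).
Proof.
set M' := coframe x j *m M *m frame x j.
have {1}-> : M = frame x j *m M' *m coframe x j.
  by rewrite /M' !mulmxA coframeK mul1mx -mulmxA coframeK mulmx1.
rewrite {1}(matrix_sum_delta M') mulmx_sumr mulmx_suml linear_sum.
apply: eq_bigr => a _; rewrite mulmx_sumr mulmx_suml linear_sum.
by apply: eq_bigr => b _; rewrite -scalemxAr -scalemxAl linearZ.
Qed.

Lemma stalkEndE_basis x a b :
  stalkEndE p L xi x (fun j => frame x j *m delta_mx a b *m coframe x j).
Proof.
apply/stalkEndE_frame => c c'.
apply: stalkO_ext (stalkO_scal x ((c == a) && (c' == b))%:R) => j.
by rewrite !mulmxA frameK mul1mx -mulmxA frameK mulmx1 mxE rmorph_nat.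
Qed.

Lemma hom_over_stalkEndE (U : pred (cycle_point K n)) (h : mx_functional K n d) :
  hom_over U (stalkEndE p L xi) h <->
  forall x, U x -> forall a b,
    stalkO x (fun j => h j (frame x j *m delta_mx a b *m coframe x j)).
Proof.
split=> [hU x Ux a b|hU x Ux M /stalkEndE_frame Mx].
  by apply: hU => //; apply: stalkEndE_basis.
apply: stalkO_ext (fun j => esym (functional_frame (h j) x j (M j))) _.
apply: stalkO_sum => a _; apply: stalkO_sum => b _.
exact: stalkO_mul (Mx a b) (hU x Ux a b).
Qed.

Lemma dlsubmx_mul0 (A B : 'M[FF]_(d + 1)) :
  dlsubmx A = 0 -> dlsubmx B = 0 -> dlsubmx (A *m B) = 0.
Proof.
move=> A0 B0; rewrite -(submxK A) -(submxK B) mulmx_block block_mxKdl A0 B0.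
by rewrite mul0mx mulmx0 addr0.
Qed.

Lemma dlsubmx_conj (A B M : 'M[FF]_(d + 1)) :
  dlsubmx A = 0 -> dlsubmx B = 0 -> dlsubmx M = 0 ->
  dlsubmx (A *m M *m B) = 0.
Proof. by move=> A0 B0 M0; rewrite !dlsubmx_mul0. Qed.

Lemma dlsubmx_delta (a b : 'I_(d + 1)) : ~~ ((d <= a)%N && (b < d)%N) ->
  dlsubmx (delta_mx a b : 'M[FF]_(d + 1)) = 0.
Proof.
move=> ab; apply/matrixP => k l; rewrite !mxE.
case: eqP => // ka; case: eqP => // lb; case/negP: ab.
by rewrite -ka -lb /= leq_addr ltn_ord.
Qed.

(** The frame and its inverse are block upper triangular, so conjugation preserves a zero lower left
    block; that block is simply left out of the test. *)
Lemma hom_over_stalkEndEW (U : pred (cycle_point K n)) (h : mx_functional K n d) :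
  hom_over U (stalkEndEW p L xi) h <->
  forall x, U x -> forall a b : 'I_(d + 1), ~~ ((d <= a)%N && (b < d)%N) ->
    stalkO x (fun j => h j (frame x j *m delta_mx a b *m coframe x j)).
Proof.
split=> [hU x Ux a b ab|hU x Ux M [/stalkEndE_frame Mx M0]].
  apply: hU => //; split; first exact: stalkEndE_basis.
  move=> j; apply: dlsubmx_conj; rewrite ?block_mxKdl //.
  exact: dlsubmx_delta.
apply: stalkO_ext (fun j => esym (functional_frame (h j) x j (M j))) _.
apply: stalkO_sum => a _; apply: stalkO_sum => b _.
have [/andP[da bd]|ab] := boolP ((d <= a)%N && (b < d)%N); last first.
  exact: stalkO_mul (Mx a b) (hU x Ux a b ab).
apply: stalkO_ext (stalkO_0 x) => j.
have /matrixP : dlsubmx (coframe x j *m M j *m frame x j) = 0.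
  by rewrite dlsubmx_conj ?block_mxKdl.
have -> : a = rshift d 0.
  by apply: val_inj; have := ltn_ord a; rewrite /= addn0; lia.
have -> : b = lshift 1 (Ordinal bd) by apply: val_inj.
by move=> /(_ 0 (Ordinal bd)); rewrite !mxE => ->; rewrite mul0r.
Qed.

(** * Homomorphisms to O_C in terms of their block coefficients *)

Section Coefficients.
Variables (h : mx_functional K n d).

Definition coef_ul k l j := h j (block_mx (delta_mx k l) 0 0 0).
Definition coef_ur k j := h j (block_mx 0 (delta_mx k 0) 0 0).
Definition coef_dl l j := h j (block_mx 0 0 (delta_mx 0 l) 0).
Definition coef_dr j := h j (block_mx 0 0 0 (delta_mx 0 0)).

(** The conjugated elementary matrices have rank one, so their values split into the four blocks as
    products of a column and a row. *)
Lemma functional_outer j (u v : 'I_(d + 1) -> FF) (M : 'M[FF]_(d + 1)) :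
  (forall a b, M a b = u a * v b) ->
  h j M = \sum_k \sum_l u (lshift 1 k) * v (lshift 1 l) * coef_ul k l j +
    (\sum_k u (lshift 1 k) * coef_ur k j) * v (rshift d 0) +
    u (rshift d 0) * (\sum_l v (lshift 1 l) * coef_dl l j +
      v (rshift d 0) * coef_dr j).
Proof.
move=> ME; rewrite functional_sum_delta big_split_ord big_ord1 /=; congr (_ + _).
  rewrite mulr_suml -big_split; apply: eq_bigr => k _ /=.
  rewrite big_split_ord big_ord1 /=; congr (_ + _).
    apply: eq_bigr => l _.
    by rewrite ME delta_block_ul.
  rewrite ME mulrAC; congr (_ * _ * _).
  by rewrite delta_block_ur.
rewrite big_split_ord big_ord1 /= mulrDr mulr_sumr; congr (_ + _).
  apply: eq_bigr => l _; rewrite ME mulrA; congr (_ * _).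
  by rewrite delta_block_dl.
by rewrite ME mulrA delta_block_dr.
Qed.

Lemma mul_delta_entry x j a b c c' :
  (frame x j *m delta_mx a b *m coframe x j) c c' =
  frame x j c a * coframe x j b c'.
Proof.
rewrite -(mul_delta_mx (0 : 'I_1)) mulmxA -colE -mulmxA -rowE mxE big_ord1.
by rewrite !mxE.
Qed.

Let basis x j a b := h j (frame x j *m delta_mx a b *m coframe x j).

Lemma basis_outer x j a b :
  let u c := frame x j c a in let v c := coframe x j b c in
  basis x j a b = \sum_k \sum_l u (lshift 1 k) * v (lshift 1 l) * coef_ul k l j +
    (\sum_k u (lshift 1 k) * coef_ur k j) * v (rshift d 0) +
    u (rshift d 0) * (\sum_l v (lshift 1 l) * coef_dl l j +
      v (rshift d 0) * coef_dr j).
Proof. by apply: functional_outer => c c'; apply: mul_delta_entry. Qed.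

Lemma frame_ul x j k l : frame x j (lshift 1 k) (lshift 1 l) = (k == l)%:R.
Proof. by rewrite block_mxEul mxE. Qed.

Lemma frame_dl x j l : frame x j (rshift d 0) (lshift 1 l) = 0.
Proof. by rewrite block_mxEdl mxE. Qed.

Lemma frame_ur x j k : frame x j (lshift 1 k) (rshift d 0) =
  - (local_xi x k j * generator x j).
Proof. by rewrite block_mxEur mxE. Qed.

Lemma frame_dr x j : frame x j (rshift d 0) (rshift d 0) = generator x j.
Proof. by rewrite block_mxEdr mxE. Qed.

Lemma coframe_ul x j k l : coframe x j (lshift 1 k) (lshift 1 l) = (l == k)%:R.
Proof. by rewrite block_mxEul mxE eq_sym. Qed.

Lemma coframe_dl x j l : coframe x j (rshift d 0) (lshift 1 l) = 0.
Proof. by rewrite block_mxEdl mxE. Qed.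

Lemma coframe_ur x j k :
  coframe x j (lshift 1 k) (rshift d 0) = local_xi x k j.
Proof. by rewrite block_mxEur mxE. Qed.

Lemma coframe_dr x j : coframe x j (rshift d 0) (rshift d 0) =
  (generator x j)^-1.
Proof. by rewrite block_mxEdr mxE. Qed.

Lemma basis_ul x j k l : basis x j (lshift 1 k) (lshift 1 l) =
  coef_ul k l j + coef_ur k j * local_xi x l j.
Proof.
rewrite basis_outer /= frame_dl mul0r addr0 coframe_ur.
under eq_bigr do under eq_bigr do rewrite frame_ul coframe_ul -mulrA.
under eq_bigr do rewrite -mulr_sumr.
rewrite (sum_delta (fun k' => \sum_l' (l' == l)%:R * coef_ul k' l' j)).
rewrite (sum_delta (fun l' => coef_ul k l' j)).
under eq_bigr do rewrite frame_ul.
by rewrite (sum_delta (fun k' => coef_ur k' j)).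
Qed.

Lemma basis_ur x j k : basis x j (lshift 1 k) (rshift d 0) =
  (generator x j)^-1 * coef_ur k j.
Proof.
rewrite basis_outer /= frame_dl mul0r addr0 coframe_dr.
under eq_bigr do under eq_bigr do rewrite coframe_dl mulr0 mul0r.
under eq_bigr do rewrite big1_eq.
rewrite big1_eq add0r mulrC; congr (_ * _).
under eq_bigr do rewrite frame_ul.
by rewrite (sum_delta (fun k' => coef_ur k' j)).
Qed.

Lemma basis_dr x j : basis x j (rshift d 0) (rshift d 0) =
  coef_dr j - \sum_k coef_ur k j * local_xi x k j.
Proof.
rewrite basis_outer /= coframe_dr frame_dr.
under eq_bigr do under eq_bigr do rewrite coframe_dl mulr0 mul0r.
under eq_bigr do rewrite big1_eq.
rewrite big1_eq add0r addrC mulrDr mulVKf ?generator_neq0 //.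
under eq_bigr do rewrite coframe_dl mul0r.
rewrite big1_eq mulr0 add0r; congr (_ + _).
rewrite mulr_suml -sumrN; apply: eq_bigr => k _.
rewrite frame_ur mulNr mulNr; congr (- _).
by rewrite mulrAC mulfK ?generator_neq0 // mulrC.
Qed.

(** At a marked point, regularity of this value determines [coef_dl] up to L^dual; this is where the
    connecting map arises. *)
Lemma basis_dl x j l : basis x j (rshift d 0) (lshift 1 l) =
  generator x j * (coef_dl l j - (\sum_k coef_ul k l j * local_xi x k j +
    (\sum_k coef_ur k j * local_xi x k j - coef_dr j) * local_xi x l j)).
Proof.
rewrite basis_outer /= coframe_ur frame_dr.
under [in X in _ + X]eq_bigr do rewrite coframe_ul.
rewrite (sum_delta (fun l' => coef_dl l' j)).
under eq_bigr do under eq_bigr do rewrite coframe_ul -mulrA mulrCA.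
under eq_bigr do rewrite (sum_delta (fun l' => _ * coef_ul _ l' j)).
have E1 (F : 'I_d -> FF) :
    \sum_k frame x j (lshift 1 k) (rshift d 0) * F k =
    - generator x j * \sum_k F k * local_xi x k j.
  rewrite mulr_sumr; apply: eq_bigr => k _.
  by rewrite frame_ur !mulNr; congr (- _); rewrite -mulrA mulrCA [F k * _]mulrC.
rewrite (E1 (fun k => coef_ul k l j)) (E1 (fun k => coef_ur k j)).
have E2 (F : comPzRingType) (g s t y u v : F) :
  - g * s + - g * t * y + g * (u + y * v) = g * (u - (s + (t - v) * y)) by ring.
exact: E2.
Qed.

(** The functions alpha_(k l), the sections beta_k of L and the function delta describing a
    homomorphism on the subbundle preserving W^dual (x) O. *)
Definition EW_conditions x : Prop :=
  [/\ forall k l, stalkO x (fun j => coef_ul k l j + coef_ur k j * local_xi x l j),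
      forall k, stalkO x (fun j => (generator x j)^-1 * coef_ur k j) &
      stalkO x (fun j => coef_dr j - \sum_k coef_ur k j * local_xi x k j)].

Lemma hom_over_EW_coef (U : pred (cycle_point K n)) :
  hom_over U (stalkEndEW p L xi) h <-> forall x, U x -> EW_conditions x.
Proof.
split=> [/hom_over_stalkEndEW hU x Ux|hU].
  split=> [k l|k|].
  - apply: stalkO_ext (hU x Ux (lshift 1 k) (lshift 1 l) _) => [j|].
      exact: basis_ul.
    by have := ltn_ord k; rewrite /=; lia.
  - apply: stalkO_ext (hU x Ux (lshift 1 k) (rshift d 0) _) => [j|].
      exact: basis_ur.
    by have := ltn_ord k; rewrite /=; lia.
  apply: stalkO_ext (hU x Ux (rshift d 0) (rshift d 0) _) => [j|].
    exact: basis_dr.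
  by rewrite /= addn0 ltnn andbF.
apply/hom_over_stalkEndEW => x Ux a b.
have [Cul Cur Cdr] := hU x Ux.
case: (split_ordP a) => k ->; case: (split_ordP b) => l -> => ab.
- by apply: stalkO_ext (Cul k l) => j; rewrite -basis_ul.
- by apply: stalkO_ext (Cur k) => j; rewrite ord1 -basis_ur.
- by have := ltn_ord l; move: ab; rewrite /=; lia.
by apply: stalkO_ext Cdr => j; rewrite !ord1 -basis_dr.
Qed.

Lemma hom_over_E_coef (U : pred (cycle_point K n)) :
  hom_over U (stalkEndE p L xi) h <-> forall x, U x -> EW_conditions x /\
    forall l, stalkO x (fun j => generator x j * (coef_dl l j -
      (\sum_k coef_ul k l j * local_xi x k j +
       (\sum_k coef_ur k j * local_xi x k j - coef_dr j) * local_xi x l j))).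
Proof.
split=> [hU x Ux|hU].
  split; last first.
    move=> l; move/hom_over_stalkEndE: hU.
    move=> /(_ x Ux (rshift d 0) (lshift 1 l)); apply: stalkO_ext => j.
    exact: basis_dl.
  move: x Ux; apply/hom_over_EW_coef => x Ux M [ME _]; exact: hU.
apply/hom_over_stalkEndE => x Ux a b.
have [[Cul Cur Cdr] Cdl] := hU x Ux.
case: (split_ordP a) => k ->; case: (split_ordP b) => l ->.
- by apply: stalkO_ext (Cul k l) => j; rewrite -basis_ul.
- by apply: stalkO_ext (Cur k) => j; rewrite ord1 -basis_ur.
- by apply: stalkO_ext (Cdl l) => j; rewrite ord1 -basis_dl.
by apply: stalkO_ext Cdr => j; rewrite !ord1 -basis_dr.
Qed.

End Coefficients.

End Frames.

Lemma extends_coef (K : closedFieldType) (n d : nat) (h g : mx_functional K n d) :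
  (forall k l j, coef_ul h k l j = coef_ul g k l j) ->
  (forall k j, coef_ur h k j = coef_ur g k j) ->
  (forall j, coef_dr h j = coef_dr g j) -> extends h g.
Proof.
move=> Eul Eur Edr j M M0; rewrite !functional_sum_delta.
apply: eq_bigr => a _; apply: eq_bigr => b _.
case: (split_ordP a) => k ->; case: (split_ordP b) => l ->.
- by rewrite delta_block_ul -/(coef_ul h k l j) -/(coef_ul g k l j) Eul.
- by rewrite ord1 delta_block_ur -/(coef_ur h k j) -/(coef_ur g k j) Eur.
- by move/matrixP: M0 => /(_ k l); rewrite !mxE => ->; rewrite !mul0r.
by rewrite !ord1 delta_block_dr -/(coef_dr h j) -/(coef_dr g j) Edr.
Qed.

Lemma functional_ex (K : closedFieldType) (n d : nat)
    (ul : 'I_d -> 'I_d -> cycle_fun K n) (ur dl : 'I_d -> cycle_fun K n)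
    (dr : cycle_fun K n) :
  exists h : mx_functional K n d,
    [/\ forall k l j, coef_ul h k l j = ul k l j,
        forall k j, coef_ur h k j = ur k j,
        forall l j, coef_dl h l j = dl l j & forall j, coef_dr h j = dr j].
Proof.
pose FF := {fraction {poly K}}.
pose H j : 'M[FF]_(d + 1) := block_mx (\matrix_(k, l) ul k l j)
  (\col_k ur k j) (\row_l dl l j) (\matrix_(_, _) dr j).
pose f j (M : 'M[FF]_(d + 1)) : FF := \sum_a \sum_b H j a b * M a b.
have fl j : scalar (f j).
  move=> c M N; rewrite /f /GRing.scale /= mulr_sumr -big_split.
  apply: eq_bigr => a _ /=; rewrite mulr_sumr -big_split.
  by apply: eq_bigr => b _ /=; rewrite !mxE mulrDr mulrCA.
pose h j : {scalar 'M[FF]_(d + 1)} :=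
  HB.pack (f j) (GRing.isLinear.Build FF 'M[FF]_(d + 1) FF *%R (f j) (fl j)).
have hd j a b : h j (delta_mx a b) = H j a b.
  rewrite /h /= /f (bigD1 a) //= (bigD1 b) //= [delta_mx a b a b]mxE !eqxx mulr1.
  rewrite big1 => [|b' /negPf nb]; last first.
    by rewrite [delta_mx _ _ _ _]mxE nb andbF mulr0.
  rewrite big1 ?addr0 // => a' /negPf na; rewrite big1 // => b' _.
  by rewrite [delta_mx _ _ _ _]mxE na mulr0.
exists h; split=> [k l j|k j|l j|j].
- by rewrite /coef_ul -delta_block_ul hd block_mxEul mxE.
- by rewrite /coef_ur -delta_block_ur hd block_mxEur mxE.
- by rewrite /coef_dl -delta_block_dl hd block_mxEdl mxE.
by rewrite /coef_dr -delta_block_dr hd block_mxEdr mxE.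
Qed.

(** * The Feigin-Odesskii bracket *)

Section Bracket.
Variables (K : closedFieldType) (V W : vectType K) (n d : nat).
Variables (e : n.-tuple V) (b : d.-tuple W).
Hypotheses (he : basis_of fullv e) (hb : basis_of fullv b).
Implicit Types (phi : 'Hom(W, V)) (A : 'Hom(V, W)) (i m : 'I_n) (k l : 'I_d).

(* The lift of Pi_{W,L} to Hom(W, V) read off [connecting_map_formula]. *)
Definition FO_hom phi A : 'Hom(W, V) := linfun (fun w : W =>
  \sum_(i < n) (\sum_(m < n | (m <= i)%N)
      coord e i (phi (A (tnth e m))) * coord e m (phi w) +
    coord e i (phi w) *
      \sum_(m < n | (m < i)%N) coord e m (phi (A (tnth e m)))) *: tnth e i).

Lemma coord_sum (F : 'I_n -> K) i : coord e i (\sum_m F m *: tnth e m) = F i.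
Proof.
rewrite linear_sum /=.
under eq_bigr do rewrite linearZ /= (coord_tnth he) mulrC eq_sym.
exact: sum_delta.
Qed.

Lemma coord_inj u v : (forall i, coord e i u = coord e i v) -> u = v.
Proof.
move=> uv; rewrite (coord_basisE he u) (coord_basisE he v).
by apply: eq_bigr => i _; rewrite uv.
Qed.

Lemma coord_FO_hom phi A i w : coord e i (FO_hom phi A w) =
  \sum_(m < n | (m <= i)%N)
      coord e i (phi (A (tnth e m))) * coord e m (phi w) +
  coord e i (phi w) *
      \sum_(m < n | (m < i)%N) coord e m (phi (A (tnth e m))).
Proof.
rewrite /FO_hom linfun_linearE ?coord_sum // => c x y.
rewrite scaler_sumr -big_split; apply: eq_bigr => j _ /=.
rewrite scalerA -scalerDl; congr (_ *: _).
rewrite !linearP /=.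
under eq_bigr do rewrite !linearP /= mulrDr mulrCA.
rewrite big_split /= -mulr_sumr; ring.
Qed.

Definition FO_map phi : 'Hom('Hom(V, W), 'Hom(W, V)) := linfun (FO_hom phi).

Lemma coord_FO_map phi A i w : coord e i (FO_map phi A w) =
  \sum_(m < n | (m <= i)%N)
      coord e i (phi (A (tnth e m))) * coord e m (phi w) +
  coord e i (phi w) *
      \sum_(m < n | (m < i)%N) coord e m (phi (A (tnth e m))).
Proof.
rewrite /FO_map linfun_linearE ?coord_FO_hom // => c A1 A2.
apply/lfunP => u; apply: coord_inj => j.
rewrite add_lfunE scale_lfunE linearP /= !coord_FO_hom.
under eq_bigr do rewrite add_lfunE scale_lfunE !linearP /= mulrDl -mulrA.
under [X in _ + _ * X]eq_bigr do rewrite add_lfunE scale_lfunE !linearP /=.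
rewrite !big_split /= -!mulr_sumr; ring.
Qed.

Lemma coord_comp phi A i u : coord e i (phi (A u)) =
  \sum_k coord e i (phi (tnth b k)) * coord b k (A u).
Proof.
rewrite {1}(coord_basisE hb (A u)) !linear_sum.
by apply: eq_bigr => k _; rewrite !linearZ /= mulrC.
Qed.

(* Half the twisted standard bivector and [FO_map] differ by terms containing
   [v1 (phi _)] or [v2 (phi _)]. *)
Lemma twisted_FO_map phi w1 w2 v1 v2 :
  annihilates v1 phi -> annihilates v2 phi ->
  twisted_standard e phi w1 v1 w2 v2 =
  2 * ev v2 (FO_map phi (pure_cotangent w1 v1) w2).
Proof.
move=> v10 v20.
have pureE u : pure_cotangent w1 v1 u = ev v1 u *: w1.
  rewrite /pure_cotangent linfun_linearE // => c x y.
  by rewrite linearP scalerDl scalerA.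
have pair v u : ev v u = \sum_i ev v (tnth e i) * coord e i u.
  rewrite {1}(coord_basisE he u) ev_sum; apply: eq_bigr => i _.
  by rewrite evZ mulrC.
have z (v : 'Hom(V, K^o)) w : annihilates v phi ->
    \sum_i ev v (tnth e i) * coord e i (phi w) = 0.
  by move=> v0; rewrite -pair; apply: v0.
set a := fun i => ev v1 (tnth e i); set c := fun i => ev v2 (tnth e i).
set x := fun i => coord e i (phi w1); set y := fun i => coord e i (phi w2).
have ax : \sum_i a i * x i = 0 by exact: z.
have ay : \sum_i a i * y i = 0 by exact: z.
have cross : \sum_i \sum_j a i * c j * (x i * y j + x j * y i) = 0.
  have := congr2 (fun s t => s * (\sum_j c j * y j) + t * (\sum_j c j * x j)) ax ay.
  rewrite !mul0r addr0 => E; rewrite -[RHS]E !mulr_suml -big_split.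
  apply: eq_bigr => i _ /=; rewrite !mulr_sumr -big_split.
  by apply: eq_bigr => j _ /=; ring.
(* Adding the vanishing sum [cross] replaces the sign s by s + 1, which is 2 for i < j, 1 for i = j
   and 0 for i > j. On the diagonal the two products coincide, so a single doubled term accounts for
   both. *)
rewrite twistedE -[LHS]addr0 -[X in _ + X]cross pair mulr_sumr.
rewrite -big_split /=; under eq_bigr do rewrite -big_split /=.
rewrite exchange_big; apply: eq_bigr => j _ /=.
have pE i m : coord e i (phi (pure_cotangent w1 v1 (tnth e m))) = a m * x i.
  by rewrite pureE !linearZ.
rewrite coord_FO_map; under [X in X + _]eq_bigr do rewrite pE.
under [X in _ + _ * X]eq_bigr do rewrite pE.
rewrite -/(c j) -/(y j) !mulrDr !mulr_sumr.
rewrite [X in _ = X + _]big_mkcond [X in _ = _ + X]big_mkcond -big_split.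
apply: eq_bigr => m _ /=; rewrite -/(a m) -/(c j) -/(x m) -/(y m) -/(x j) -/(y j).
rewrite /sgn_lt; case: ltngtP => [_|_|/val_inj ->] /=; ring.
Qed.

(** * Existence and uniqueness of the bracket attached to a line bundle *)

Section LineBundle.
Variables (p : 'I_n -> K) (L : cycle_sheaf K n) (theta : cycle_fun K n).
Hypotheses (hn : (1 < n)%N) (p0 : forall i, p i != 0).
Hypothesis Ltheta : iso_by theta (O_marked p) L.

(** Multiplication by [theta] turns cochains of L^dual into those of [connecting_map_formula]; the
    undetermined gluing constants then contribute only vectors of phi(W). *)
Lemma FO_map_bracket : FO_bracket e b L p theta FO_map.
Proof.
move=> phi _ sigma tau xi h h1 h2 A eta tauP xiP hP aP h1P e1 h2P e2 etaP.
pose ph i l := coord e i (phi (tnth b l)).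
pose a k m := coord b k (A (tnth e m)).
pose S k j := \sum_i scal (a k i) * std_section p i j.
have urE k j : coef_ur h k j = theta j * S k j.
  rewrite /coef_ur aP mulr_sumr; apply: eq_bigr => i _.
  by rewrite /sigma mulrCA.
have ul1 k l j : coef_ul h1 k l j = coef_ul h k l j.
  by apply: e1; rewrite block_mxKdl.
have ul2 k l j : coef_ul h2 k l j = coef_ul h k l j.
  by apply: e2; rewrite block_mxKdl.
have ur2 k j : coef_ur h2 k j = coef_ur h k j.
  by apply: e2; rewrite block_mxKdl.
have dr2 j : coef_dr h2 j = coef_dr h j.
  by apply: e2; rewrite block_mxKdl.
have {}hP x := (hom_over_EW_coef p0 Ltheta xi h predT).1 hP x isT.
have {}h1P := (hom_over_E_coef p0 Ltheta xi h1 _).1 h1P.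
have {}h2P := (hom_over_E_coef p0 Ltheta xi h2 _).1 h2P.
have unm x k j : ~~ marked p x -> local_xi p xi x k j = 0.
  by rewrite /local_xi => /negPf->.
have unmg x j : ~~ marked p x -> generator p theta x j = theta j.
  by rewrite /generator => /negPf->; rewrite mulr1.
have mk j : marked p (j, p j) by rewrite /marked /=.
have mkx j k : local_xi p xi (j, p j) k j = xi k j by rewrite /local_xi mk.
have mkg j : generator p theta (j, p j) j = theta j * pole p j.
  by rewrite /generator mk eqxx.
have atE j f : stalkO (j, p j) f -> regular_at (p j) (f j).
  by move/(stalkO_marked p0 _ (mk j)).
have Sx k l j : coef_ur h k j * xi l j = S k j * (theta j * xi l j).
  by rewrite urE mulrCA mulrA.
have [] := @connecting_map_formula K n p hn p0 tau tauP d ph a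
  (fun l j => theta j * xi l j) (fun l j => theta j * coef_dl h1 l j)
  (fun l j => theta j * coef_dl h2 l j) (coef_ul h) (coef_dr h).
- move=> l i; rewrite -[RHS]xiP; congr tau; apply/funext => j.
  by rewrite /sigma mulrA [theta j * _]mulrC.
- move=> k l x xp; have [+ _ _] := hP x => /(_ k l); apply: stalkO_ext => j.
  by rewrite unm // mulr0 addr0.
- move=> k l j; have [+ _ _] := hP (j, p j) => /(_ k l)/atE.
  by rewrite mkx Sx.
- move=> x xp; have [_ _] := hP x; apply: stalkO_ext => j.
  by rewrite big1 ?subr0 // => k _; rewrite unm // mulr0.
- move=> j; have [_ _ /atE] := hP (j, p j).
  by under eq_bigr do rewrite mkx Sx.
- move=> l x xp; have [_ /(_ l)] := h1P x xp; apply: stalkO_ext => j.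
  rewrite unmg // unm // mulr0 addr0 big1 ?subr0 // => k _.
  by rewrite unm // mulr0.
- move=> l j; have [_ /(_ l)/atE] := h2P (j, p j) (mk j).
  rewrite mkg dr2; under eq_bigr do rewrite ul2 mkx.
  under [X in _ + (X - _) * _]eq_bigr do rewrite ur2 mkx Sx.
  rewrite mkx [theta j * pole p j]mulrC -mulrA [theta j * (_ - _)]mulrBr.
  rewrite [theta j * (_ + _)]mulrDr mulr_sumr [theta j * (_ * xi l j)]mulrCA.
  by under [\sum_k theta j * (coef_ul h k l j * _)]eq_bigr do rewrite mulrCA.
move=> c [c0 tauE].
(* The indeterminacy is exhibited as phi of an explicit vector of W. *)
have key l : (FO_map phi A - eta) (tnth b l) =
    phi (\sum_k c k l *: tnth b k + c0 *: tnth b l).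
  apply: coord_inj => i; rewrite add_lfunE opp_lfunE linearB /= etaP.
  transitivity (coord e i (FO_map phi A (tnth b l)) - tau (fun j =>
     std_section p i j * (theta j * coef_dl h1 l j - theta j * coef_dl h2 l j))).
    congr (_ - tau _); apply/funext => j.
    by rewrite /sigma -mulrBr mulrA [theta j * _]mulrC.
  rewrite tauE coord_FO_map.
  rewrite !linearD !linearZ !linear_sum /= -/(ph i l).
  have -> : \sum_(m < n | (m <= i)%N)
      coord e i (phi (A (tnth e m))) * coord e m (phi (tnth b l)) =
      \sum_k ph i k * \sum_(m < n | (m <= i)%N) a k m * ph m l.
    under eq_bigr do rewrite coord_comp mulr_suml.
    rewrite exchange_big; apply: eq_bigr => k _; rewrite mulr_sumr.
    by apply: eq_bigr => m _; rewrite mulrA.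
  have -> : \sum_(m < n | (m < i)%N) coord e m (phi (A (tnth e m))) =
      \sum_(m < n | (m < i)%N) \sum_k ph m k * a k m.
    by apply: eq_bigr => m _; rewrite coord_comp.
  rewrite opprB addrCA subrr addr0 mulrC; congr (_ + _).
  by apply: eq_bigr => k _; rewrite !linearZ /= mulrC.
apply/subvP => u /memv_imgP[w _ ->].
rewrite (coord_basisE hb w) linear_sum; apply: memv_suml => l _.
by rewrite linearZ memvZ //= key memv_img // memvf.
Qed.

(** Constructs admissible data with alpha_1(h) = A, so that [FO_at] really pins Pi A down modulo
    phi(W). *)
Lemma FO_data_ex phi A : (forall w, A (phi w) = 0) ->
  exists eta : 'Hom(W, V), forall Pi,
    FO_at e b L p theta phi Pi -> (limg (Pi A - eta) <= limg phi)%VS.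
Proof.
move=> Aphi; have [th0 _] := Ltheta.
have [tau tauP] := normalized_trace_ex p0.
pose ph i l := coord e i (phi (tnth b l)).
pose a k m := coord b k (A (tnth e m)).
pose S k j := \sum_i scal (a k i) * std_section p i j.
pose x0 l j := scal (ph j l) * pole p j.
pose xi l j := (theta j)^-1 * x0 l j.
pose w k l m := ph m l * a k m.
pose t m := \sum_k ph m k * a k m.
(* A phi = 0 yields the vanishing sums required to close the gluing recursion at the last node. *)
have aph k l : \sum_m w k l m = 0.
  transitivity (coord b k (A (phi (tnth b l)))); last by rewrite Aphi linear0.
  rewrite [in RHS](coord_basisE he (phi (tnth b l))) !linear_sum.
  by apply: eq_bigr => m _; rewrite !linearZ.
have t0 : \sum_m t m = 0.
  by rewrite /t exchange_big big1 // => k _; apply: aph.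
pose u k l j := ph j l * a k (ordS j).
pose v j := \sum_k ph j k * a k (ordS j).
have Sx0 k l j : S k j * x0 l j =
    scal (u k l j) * (pole p j + pole p j ^+ 2) - scal (w k l j) * pole p j ^+ 2.
  by rewrite /S section_comb /x0 /u /w !rmorphM /= section_pole.
have sumSx0 j : \sum_k S k j * x0 k j =
    scal (v j) * (pole p j + pole p j ^+ 2) - scal (t j) * pole p j ^+ 2.
  rewrite /v /t !rmorph_sum !mulr_suml -sumrB.
  by apply: eq_bigr => k _; apply: Sx0.
(* The solutions of [glue_ex] with initial constant 0, the one for [dl] with its sign changed:
   adding S x0 to [al], or subtracting its sum from [dl], leaves constants. *)
pose al k l (j : 'I_n) :=
  scal (- \sum_(m < n | (m <= j)%N) w k l m) - S k j * x0 l j.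
pose dl (j : 'I_n) :=
  - (scal (- \sum_(m < n | (m <= j)%N) t m) - \sum_k S k j * x0 k j).
pose be k j := theta j * S k j.
(* The lower left block over U2 is chosen so that its regularity condition reads 0; over U1 the zero
   block does the same. *)
pose g2 l j := \sum_k al k l j * xi k j +
  (\sum_k be k j * xi k j - dl j) * xi l j.
have [h1 [h1ul h1ur h1dl h1dr]] := functional_ex al be (fun _ _ => 0) dl.
have [h2 [h2ul h2ur h2dl h2dr]] := functional_ex al be g2 dl.
have alU k l x : ~~ marked p x -> stalkO x (al k l).
  move=> xp; have := glue_ex hn p0 (u k l) (aph k l) xp.
  by apply: stalkO_ext => j; rewrite -Sx0.
have dlU x : ~~ marked p x -> stalkO x dl.
  move=> xp; have := stalkO_opp (glue_ex hn p0 v t0 xp).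
  by apply: stalkO_ext => j; rewrite -sumSx0.
have SU k x : ~~ marked p x -> stalkO x (S k).
  move=> xp; apply: stalkO_sum => i _.
  by apply: stalkO_mul; [exact: stalkO_scal | exact: unmarked_section].
have SM k j : regular_at (p j) (local_coord p j * S k j).
  rewrite /S mulr_sumr; apply: regular_at_sum => i _; rewrite mulrCA.
  by apply: regular_atM; [exact: regular_at_scal | exact: marked_section].
have bexi k l j : be k j * xi l j = S k j * x0 l j.
  by rewrite /be /xi mulrACA divff // mul1r.
have alM k l j : al k l j + be k j * xi l j =
    scal (- \sum_(m < n | (m <= j)%N) w k l m).
  by rewrite bexi subrK.
have dlM j : dl j - \sum_k be k j * xi k j =
    scal (\sum_(m < n | (m <= j)%N) t m).
  under eq_bigr do rewrite bexi.
  by rewrite /dl opprB addrAC subrr add0r rmorphN opprK.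
have EW (h : mx_functional K n d) :
    (forall k l j, coef_ul h k l j = al k l j) ->
    (forall k j, coef_ur h k j = be k j) -> (forall j, coef_dr h j = dl j) ->
    forall x, EW_conditions p theta xi h x.
  move=> hul hur hdr x; have [xm|xu] := boolP (marked p x).
    have [j ->] : exists j, x = (j, p j).
      by exists x.1; move: xm; rewrite /marked => /eqP <-; case: (x).
    have mk : marked p (j, p j) by rewrite /marked /=.
    split=> [k l|k|]; apply/(stalkO_marked p0 _ mk) => /=.
    - rewrite hul hur /local_xi mk alM; exact: regular_at_scal.
    - rewrite hur /generator mk eqxx /= /be invfM mulrACA mulVf // mul1r.
      by rewrite /pole invrK; apply: SM.
    rewrite hdr; under eq_bigr do rewrite hur /local_xi mk.
    by rewrite dlM; apply: regular_at_scal.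
  have lx k j : local_xi p xi x k j = 0 by rewrite /local_xi (negPf xu).
  split=> [k l|k|].
  - by apply: stalkO_ext (alU k l x xu) => j; rewrite hul lx mulr0 addr0.
  - apply: stalkO_ext (SU k x xu) => j.
    by rewrite hur /generator (negPf xu) /= mulr1 mulKf.
  apply: stalkO_ext (dlU x xu) => j.
  by rewrite hdr big1 ?subr0 // => k _; rewrite lx mulr0.
pose c i k := tau (fun j =>
  theta j * std_section p i j * (coef_dl h1 k j - coef_dl h2 k j)).
pose eta : 'Hom(W, V) :=
  linfun (fun y => \sum_i (\sum_k coord b k y * c i k) *: tnth e i).
have etaE i k : coord e i (eta (tnth b k)) = c i k.
  rewrite /eta linfun_linearE ?coord_sum => [|s y z].
    under eq_bigr do rewrite (coord_tnth hb).
    exact: sum_delta.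
  rewrite scaler_sumr -big_split; apply: eq_bigr => m _ /=.
  rewrite scalerA -scalerDl mulr_sumr -big_split; congr (_ *: _).
  by apply: eq_bigr => l _; rewrite linearP /= mulrDl mulrA.
(* [h1] serves both as the homomorphism on the subbundle and as its extension over U1. *)
exists eta => Pi /(_ tau xi h1 h1 h2 A eta tauP); apply.
- move=> k i; rewrite -/(ph i k).
  rewrite -(@tau_section_dual _ _ _ hn p0 _ tauP i (x0 k) (fun m => ph m k)
    (fun=> 0) (fun=> 0)).
  + by congr tau; apply/funext => j; rewrite mulrC /xi mulrACA mulVf // mul1r mulrC.
  + by move=> j; rewrite !addr0.
  + by move=> x _; apply: stalkO_0.
  by move=> j; rewrite mulr0; apply: regular_at0.
- by apply/(hom_over_EW_coef p0 Ltheta) => x _; apply: EW.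
- move=> k j; rewrite -/(coef_ur h1 k j) h1ur /be mulr_sumr.
  by apply: eq_bigr => i _; rewrite mulrCA.
- apply/(hom_over_E_coef p0 Ltheta) => x xu; split; first exact: EW.
  move=> l; apply: stalkO_ext (stalkO_0 x) => j.
  rewrite h1dl /local_xi (negPf xu) mulr0 addr0 big1 ?subr0 ?mulr0 // => k _.
  by rewrite mulr0.
- by apply: extends_coef.
- apply/(hom_over_E_coef p0 Ltheta) => x xm; split; first exact: EW.
  move=> l; apply: stalkO_ext (stalkO_0 x) => j.
  rewrite h2dl h2dr /local_xi xm.
  under eq_bigr do rewrite h2ul; under [X in (X - _) * _]eq_bigr do rewrite h2ur.
  by rewrite subrr mulr0.
- by apply: extends_coef => *; rewrite ?(h1ul, h2ul, h1ur, h2ur, h1dr, h2dr).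
by move=> k i; rewrite etaE.
Qed.

(** Any Pi and [FO_map] differ from the same [eta] by maps into phi(W), which [v2] annihilates. *)
Lemma FO_bracket_twisted Pi : FO_bracket e b L p theta Pi ->
  same_bivector_field (twisted_standard (W := W) e)
    (fun phi w1 v1 w2 v2 => 2 * bivector_of Pi phi w1 v1 w2 v2).
Proof.
move=> PiFO phi phi0 w1 w2 v1 v2 v10 v20.
rewrite twisted_FO_map //; congr (2 * _).
have [|eta etaP] := @FO_data_ex phi (pure_cotangent w1 v1).
  move=> w; rewrite /pure_cotangent linfun_linearE => [|c x y].
    by rewrite v10 scale0r.
  by rewrite linearP scalerDl scalerA.
have same Pi' : FO_bracket e b L p theta Pi' ->
    ev v2 (Pi' phi (pure_cotangent w1 v1) w2) = ev v2 (eta w2).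
  move=> /(_ phi phi0)/etaP/subvP.
  move=> /(_ ((Pi' phi (pure_cotangent w1 v1) - eta) w2)).
  rewrite memv_img ?memvf // => /(_ isT)/memv_imgP[w _].
  rewrite add_lfunE opp_lfunE => /eqP; rewrite subr_eq => /eqP->.
  by rewrite evD [ev v2 (phi w)]v20 add0r.
by rewrite (same _ FO_map_bracket) -(same _ PiFO).
Qed.

End LineBundle.
End Bracket.

Unset Implicit Arguments.

Theorem theorem3p2p2 (R : realType) (n d : nat) (hd : (0 < d < n)%N)
    (V : vectType R[i]) (e : n.-tuple V) (he : basis_of fullv e)
    (W : vectType R[i]) (b : d.-tuple W) (hb : basis_of fullv b) :
  [/\ poisson (twisted_standard (W := W) e),
      same_bivector_field (twisted_standard (W := W) e)
        (polylinear_bivector (W := W) (Bst e)) &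
      forall (L : cycle_sheaf R[i] n),
        line_bundle L -> (forall i, degree_on L i 1) ->
      forall (p : 'I_n -> R[i]) (theta : cycle_fun R[i] n),
        (forall i, p i != 0) -> iso_by theta (O_marked p) L ->
        (exists Pi, FO_bracket e b L p theta Pi) /\
        (forall Pi, FO_bracket e b L p theta Pi ->
           same_bivector_field (twisted_standard (W := W) e)
             (fun phi w1 v1 w2 v2 => 2 * bivector_of Pi phi w1 v1 w2 v2))].
Proof.
have [d0 dn] := andP hd; have hn : (1 < n)%N by exact: leq_ltn_trans d0 dn.
split; first exact: poisson_twisted he.
  by move=> phi _ w1 w2 v1 v2 _ _; rewrite polylinear_twistedE.
move=> L _ _ p theta p0 Ltheta; split.
  exists (FO_map e); exact: (@FO_map_bracket R[i] V W n d e b he hb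
    p L theta hn p0 Ltheta).
exact: (@FO_bracket_twisted R[i] V W n d e b he hb
  p L theta hn p0 Ltheta).
Qed.
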